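(* Assume the standing assumptions. Let $\pi$ be the distribution of $M=\sup_{n\ge0}S_n$. Suppose that for some $g\in\mathcal G^*$ $$\lim_{x\to\infty}\frac{1}{\overline F(x)}\int_{(x,\infty)}g(y-x)\,\pi(dy)=\frac1m\int_0^\infty g(t)\,dt.$$ Then $F\in\mathcal S^*$.
   Context: Standing assumptions: $\{\xi_n\}_{n\ge1}$ are i.i.d. real random variables with common distribution function $F$ and finite mean $\mathbf E\xi_1=-m<0$. $F$ is long-tailed: $\overline F(x)=1-F(x)>0$ for all $x$, and $\overline F(x-c)/\overline F(x)\to1$ as $x\to\infty$ for every fixed $c>0$. Notation: $S_0=0$ and $S_n=\sum_{i=1}^n\xi_i$. Function classes: $\mathcal G$ is the class of nonnegative, directly Riemann integrable functions on $\mathbb R_+$. $\mathcal G^*$ is the subclass of those $g\in\mathcal G$ that are bounded away from zero on some interval of positive length. The class $\mathcal S^*$: a distribution function $G$ on $\mathbb R$ belongs to $\mathcal S^*$ iff $\overline G(x)>0$ for all $x$ and $$\int_0^x\overline G(x-y)\overline G(y)\,dy\sim 2m_{G^+}\overline G(x)\quad(x\to\infty),$$ where $m_{G^+}=\int_0^\infty\overline G(t)\,dt$. *)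

(* Defs.v *)
From HB Require Import structures.
From mathcomp Require Import all_boot all_order all_algebra.
From mathcomp Require Import all_classical all_reals all_analysis.
Set Implicit Arguments. Unset Strict Implicit. Unset Printing Implicit Defensive.
Import Order.TTheory GRing.Theory Num.Theory.
Import numFieldNormedType.Exports.
Local Open Scope classical_set_scope.
Local Open Scope ring_scope.

Section defs.
Context {R : realType}.

Definition dR_upper (g : R -> R) (h : R) : \bar R :=
  (\sum_(0 <= n <oo)
     (h%:E * ereal_sup [set (g t)%:E | t in `[(n%:R * h)%R, (n.+1%:R * h)%R]]))%E.

Definition dR_lower (g : R -> R) (h : R) : \bar R :=
  (\sum_(0 <= n <oo)
     (h%:E * ereal_inf [set (g t)%:E | t in `[(n%:R * h)%R, (n.+1%:R * h)%R]]))%E.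

(* g is directly Riemann integrable on R_+ (Feller): for every h > 0 the upper
   (hence also the lower) sums are finite, and as h -> 0+ the upper and lower
   sums converge to the same finite limit. *)
Definition dRi (g : R -> R) : Prop :=
  (forall h, 0 < h -> (dR_upper g h < +oo)%E) /\
  exists l : R,
    (fine (dR_upper g h) @[h --> 0^'+] --> l) /\
    (fine (dR_lower g h) @[h --> 0^'+] --> l).

Definition classG (g : R -> R) : Prop :=
  (forall t, 0 <= t -> 0 <= g t) /\ dRi g.

Definition classGstar (g : R -> R) : Prop :=
  classG g /\
  exists a b c : R, [/\ 0 <= a, a < b, 0 < c &
    forall t, a <= t <= b -> c <= g t].

Definition m_plus (G : R -> R) : \bar R :=
  (\int[lebesgue_measure]_(t in `[0%R, +oo[) (1 - G t)%:E)%E.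

Definition classSstar (G : R -> R) : Prop :=
  (forall x, 0 < 1 - G x) /\
  ((\int[lebesgue_measure]_(y in `[0%R, x]) ((1 - G (x - y)) * (1 - G y)))
      / (1 - G x))%:E @[x --> +oo] --> (2%:E * m_plus G)%E.

End defs.

Definition mutually_independent d (T : measurableType d) (R : realType)
    (P : probability T R) (xi : nat -> {RV P >-> R}) : Prop :=
  forall (s : seq nat) (B : nat -> set R), uniq s ->
    (forall i, measurable (B i)) ->
    P (\big[setI/setT]_(i <- s) (xi i @^-1` B i)) =
    (\big[*%E/1%E]_(i <- s) P (xi i @^-1` B i))%E.

Definition identically_distributed d (T : measurableType d) (R : realType)
    (P : probability T R) (xi : nat -> {RV P >-> R}) : Prop :=
  forall n (B : set R), measurable B ->
    distribution P (xi n) B = distribution P (xi 0) B.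

(* random walk S_n = xi_1 + ... + xi_n; here xi_{k+1} is (xi k), S_0 = 0 *)
Definition rwalk d (T : measurableType d) (R : realType)
    (P : probability T R) (xi : nat -> {RV P >-> R}) (n : nat) (w : T) : R :=
  \sum_(k < n) xi k w.

(* M = sup_{n >= 0} S_n (real-valued; it is finite a.s. since E xi < 0) *)
Definition rwalk_sup d (T : measurableType d) (R : realType)
    (P : probability T R) (xi : nat -> {RV P >-> R}) (w : T) : R :=
  fine (ereal_sup (range (fun n => (rwalk xi n w)%:E))).

(* Main.v *)
(* Write Fb = 1 - F, and let pi be the law of the supremum M. By time shift,
   M = max(0, xi_0 + M') where M' is independent of xi_0 and has law pi.
   Testing this stationarity against z |-> min((z - x)^+, L), whose mean drift is
   close to -m on ]x, x + L], gives

     L * int_{y <= x} Fb(x + L - y) pi(dy) <= m * pi]x, x + L] + o(L) * Fb(x),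

   where the error term only needs pi]x, x + u] = O((1 + u) Fb(x)); this bound
   holds because g is bounded away from 0 on an interval.

   Summing the hypothesis over the translates x + jh and comparing g with a
   lower Riemann step function shows pi]x, x + L] <= (1 + eps)(L / m) Fb(x) for L
   large. The left side above already contains about L * Fb(x), contributed by
   the y in [0, A], so that int_{]A, x]} Fb(x + L - y) pi(dy) is o(Fb(x)) as A
   grows. The same inequality yields pi]z, z + K] >= delta * Fb(z), which allows
   replacing pi(dy) by Fb(y) dy: int_A^{x-A} Fb(z) Fb(x-z) dz is o(Fb(x)), and
   this is equivalent to F being in S^* for a long-tailed F. *)
Require Import Defs.
From HB Require Import structures.
From mathcomp Require Import all_boot all_order all_algebra.
From mathcomp Require Import all_classical all_reals all_analysis.
From mathcomp Require Import measurable_realfun ring lra.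
Import Order.TTheory GRing.Theory Num.Theory.
Import numFieldNormedType.Exports.
Set Implicit Arguments. Unset Strict Implicit. Unset Printing Implicit Defensive.
Local Open Scope classical_set_scope.
Local Open Scope ring_scope.

(** Two obstacles shape the proof. Stationarity of the law of M needs the first step to be
    independent of the whole later path, whereas the hypothesis is a product formula for finitely
    many coordinates; hence the sigma-algebra on sequences generated by the finite cylinders, which
    form a pi-system. As [fine] sends an infinite supremum to 0, the recursion for M can fail where
    the supremum is infinite, and that event must first be shown null. The second obstacle is that
    the steps have only a first moment, so M may have infinite mean. Capping the test function at L
    keeps its integrals finite, so that they cancel, and a jump s then enters the error as |s| (1 +
    min(|s|, L)) instead of s^2; this has mean o(L). The factor L in front of the integral over y <=
    x is the gain of a jump from below x to above x + L, which crosses the whole window. The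
    argument closes because the upper bound on the mass of the window and the contribution of [0, A]
    have the same leading constant, so nothing of order Fb(x) is left for the middle. *)

Section sequence_space.
Context {R : realType}.

Definition cylinder (n : nat) (B : nat -> set R) : set (nat -> R) :=
  [set u | forall i, (i < n)%N -> B i (u i)].

Definition cylinders : set (set (nat -> R)) :=
  [set C | exists n B, (forall i, measurable (B i)) /\ C = cylinder n B].

Definition seq_space : measurableType cylinders.-sigma :=
  g_sigma_algebraType cylinders.

Lemma cylindersI : setI_closed cylinders.
Proof.
move=> _ _ [n [B [mB ->]]] [k [C [mC ->]]].
(* A coordinate below the maximum but beyond n (or k) must stay unconstrained by B (or C), hence the
   guarded conditions. *)
exists (maxn n k), (fun i => [set x | ((i < n)%N -> B i x) /\ ((i < k)%N -> C i x)]).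
split=> [i|].
  case: (i < n)%N; case: (i < k)%N.
  - rewrite (_ : mkset _ = B i `&` C i); first exact: measurableI.
    by apply/seteqP; split => x /= [] h1 h2; split; auto.
  - rewrite (_ : mkset _ = B i)//; apply/seteqP; split => x /=; first by case; auto.
    by split.
  - rewrite (_ : mkset _ = C i)//; apply/seteqP; split => x /=; first by case; auto.
    by split.
  - rewrite (_ : mkset _ = setT)//; apply/seteqP; split => x //=.
apply/seteqP; split => u /=.
  by move=> [hB hC] i _; split; [exact: hB|exact: hC].
by move=> h; split => i il; have [] := h i; rewrite ?leq_max ?il ?orbT//; auto.
Qed.

Lemma measurable_coord (k : nat) :
  measurable_fun setT (fun u : seq_space => (u : nat -> R) k).
Proof.
move=> _ B mB; rewrite setTI; apply: sub_sigma_algebra.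
exists k.+1, (fun i => if i == k then B else setT); split.
  by move=> i; case: ifP.
apply/seteqP; split => u /=.
  by move=> Bu i _; case: eqVneq => // ->.
by move/(_ k (ltnSn k)); rewrite eqxx.
Qed.

Lemma measurable_to_seq_space d (T : measurableType d) (f : nat -> T -> R) :
  (forall k, measurable_fun setT (f k)) ->
  measurable_fun setT (fun w => (fun k => f k w) : seq_space).
Proof.
move=> mf; apply: (@measurability _ _ T seq_space setT _ cylinders) => //.
move=> _ [_ [n [B [mB ->]]] <-]; rewrite setTI.
rewrite (_ : _ @^-1` _ = \bigcap_(i < n) (f i @^-1` B i))//.
rewrite bigcap_mkord; apply: bigsetI_measurable => // i _.
by rewrite -[X in measurable X]setTI; exact: mf.
Qed.

End sequence_space.

(** * Independence of the first step and the rest of the path *)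

Section joint_law.
Context d (T : measurableType d) (R : realType) (P : probability T R)
  (xi : nat -> {RV P >-> R}).
Hypotheses (ind : mutually_independent xi) (idd : identically_distributed xi).

Definition steps (w : T) : @seq_space R := fun k => xi k w.
Definition steps_tail (w : T) : @seq_space R := fun k => xi k.+1 w.

Lemma measurable_steps : measurable_fun setT steps.
Proof. exact: measurable_to_seq_space. Qed.

Lemma measurable_steps_tail : measurable_fun setT steps_tail.
Proof. by apply: (@measurable_to_seq_space _ _ _ (fun k => xi k.+1)). Qed.

Lemma probability_cylinder n (B : nat -> set R) : (forall i, measurable (B i)) ->
  P (steps @^-1` cylinder n B) = (\big[*%E/1%E]_(0 <= i < n) P (xi i @^-1` B i))%E.
Proof.
move=> mB; rewrite -ind ?iota_uniq//; congr (P _).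
rewrite big_mkord; exact: (bigcap_mkord n (fun i => (xi i : T -> R) @^-1` B i)).
Qed.

(** The event is a cylinder of length n + 1 of the unshifted path, so its probability factorises;
    identical distribution then replaces each factor of step i + 1 by that of step i. *)
Lemma probability_head_cylinder D n (B : nat -> set R) : measurable D ->
  (forall i, measurable (B i)) ->
  P (xi 0%N @^-1` D `&` steps_tail @^-1` cylinder n B) =
  (P (xi 0%N @^-1` D) * P (steps @^-1` cylinder n B))%E.
Proof.
move=> mD mB; rewrite probability_cylinder//.
pose B' i := if i is j.+1 then B j else D.
have -> : xi 0%N @^-1` D `&` steps_tail @^-1` cylinder n B =
          steps @^-1` cylinder n.+1 B'.
  apply/seteqP; split => w /=.
    by move=> [h0 h] [|i]//= il; exact: h.
  move=> h; split; first exact: (h 0%N).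
  by move=> i il; exact: (h i.+1).
rewrite probability_cylinder; last by case.
rewrite big_nat_recl//=; congr (_ * _)%E.
by apply: eq_bigr => i _; exact: etrans (idd i.+1 (mB i)) (esym (idd i (mB i))).
Qed.

Let msteps : {mfun T >-> @seq_space R} :=
  HB.pack steps (isMeasurableFun.Build _ _ _ _ _ measurable_steps).

Let pairing (w : T) : R * @seq_space R := (xi 0%N w, steps_tail w).

Let measurable_pairing : measurable_fun setT pairing.
Proof. by apply/measurable_fun_pair => //; exact: measurable_steps_tail. Qed.

Let mpairing : {mfun T >-> (R * @seq_space R)%type} :=
  HB.pack pairing (isMeasurableFun.Build _ _ _ _ _ measurable_pairing).

(** For fixed D both sides are finite measures in E. They agree on the cylinders, a generating
    pi-system that contains the whole space, hence everywhere. *)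
Lemma probability_head_tail D E : measurable D -> measurable E ->
  P (xi 0%N @^-1` D `&` steps_tail @^-1` E) =
  (P (xi 0%N @^-1` D) * P (steps @^-1` E))%E.
Proof.
move=> mD; move: E.
have mD0 : measurable (xi 0%N @^-1` D) by exact: measurable_funPTI.
pose r : {nonneg R} := NngNum (fine_ge0 (measure_ge0 P (xi 0%N @^-1` D))).
pose m1 : measure (@seq_space R) R :=
  measure_function_pushforward__canonical__measure_function_Measure
    (mrestr P mD0) measurable_steps_tail.
pose m2 : measure _ R := mscale r (distribution P msteps).
move=> E mE.
have Pr : P (xi 0%N @^-1` D) = r%:num%:E by rewrite /= fineK// fin_num_measure.
rewrite setIC Pr.
suff : m1 E = m2 E by [].
apply: (@measure_unique _ R (@seq_space R) (@cylinders R) (fun=> setT)) => //.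
- exact: cylindersI.
- move=> i; exists 0%N, (fun=> setT); split => //.
  by apply/seteqP; split => // u _ i'.
- by rewrite bigcup_const//; exists 0%N.
- move=> _ [n [B [mB ->]]].
  have := probability_head_cylinder n mD mB.
  by rewrite setIC Pr.
- by move=> _; rewrite /m1/= /pushforward /mrestr ltey_eq fin_num_measure//
    preimage_setT setTI.
Qed.

(** The pair has a product law by uniqueness of the product measure, and Tonelli applies. The right
    side has [steps] in place of [steps_tail]: this is the time shift, the later path having the law
    of the whole path. *)
Lemma ge0_integral_head_tail (f : R * @seq_space R -> \bar R) :
  measurable_fun [set: R * @seq_space R] f -> (forall z, 0 <= f z)%E ->
  (\int[P]_w f (xi 0%N w, steps_tail w) =
   \int[distribution P (xi 0%N)]_s \int[P]_w f (s, steps w))%E.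
Proof.
move=> mf f0.
transitivity (\int[distribution P mpairing]_z f z)%E.
  by rewrite ge0_integral_distribution.
transitivity (\int[distribution P (xi 0%N) \x distribution P msteps]_z f z)%E.
  apply: eq_measure_integral => A mA _.
  apply/esym/product_measure_unique => // D E mD mE.
  exact: (probability_head_tail mD mE).
rewrite fubini_tonelli1//.
apply: eq_integral => s _; rewrite /fubini_F ge0_integral_distribution//.
by apply: measurableT_comp => //; exact: pair1_measurable.
Qed.

End joint_law.

(** * Supremum and running maxima of a path *)

Section path_functionals.
Context {R : realType}.
Implicit Types u : nat -> R.

Definition shift u : nat -> R := fun k => u k.+1.

Definition partial_sum u (n : nat) : R := \sum_(k < n) u k.

(** Extended-valued, so that the one-step recursion [walk_supE] holds for every path, including
    those with infinite supremum. *)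
Definition walk_sup u : \bar R := ereal_sup (range (fun n => (partial_sum u n)%:E)).

(* The maximum of the first n + 1 partial sums, by backward recursion: walk_max n.+1
   is one Lindley step applied to walk_max n of the shifted path. *)
Fixpoint walk_max (n : nat) u : R :=
  if n is k.+1 then Num.max 0 (u 0%N + walk_max k (shift u)) else 0.

Lemma partial_sumS u n : partial_sum u n.+1 = u 0%N + partial_sum (shift u) n.
Proof. by rewrite /partial_sum big_ord_recl. Qed.

Lemma partial_sum_le_sup u n : ((partial_sum u n)%:E <= walk_sup u)%E.
Proof. by apply: ereal_sup_ubound; exists n. Qed.

Lemma walk_sup_ge0 u : (0 <= walk_sup u)%E.
Proof. by have := partial_sum_le_sup u 0%N; rewrite /partial_sum big_ord0. Qed.

Lemma walk_supE u : (walk_sup u = maxe 0 ((u 0%N)%:E + walk_sup (shift u)))%E.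
Proof.
apply/eqP; rewrite eq_le; apply/andP; split.
  apply: ge_ereal_sup => _ [[|n] _ <-].
    by rewrite /partial_sum big_ord0 le_max lexx.
  rewrite partial_sumS le_max EFinD; apply/orP; right.
  by rewrite leeD2l// partial_sum_le_sup.
rewrite ge_max walk_sup_ge0/= -leeBrDl//.
apply: ge_ereal_sup => _ [n _ <-].
by rewrite leeBrDl// -EFinD -partial_sumS partial_sum_le_sup.
Qed.

(** A finite first step cannot change whether the supremum is infinite. Hence this event can be read
    off the shifted path, which is independent of that step. *)
Lemma walk_sup_shift_pinfty u : (walk_sup (shift u) == +oo%E) = (walk_sup u == +oo%E).
Proof.
rewrite [in RHS]walk_supE; have := walk_sup_ge0 (shift u).
case: (walk_sup (shift u)) => [r||]//= _.
  by rewrite -EFinD -EFin_max.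
by rewrite maxey.
Qed.

Lemma walk_max_ge0 n u : 0 <= walk_max n u.
Proof. by case: n => [|n]//=; rewrite le_max lexx. Qed.

Lemma partial_sum_le_max k n u : (k <= n)%N -> partial_sum u k <= walk_max n u.
Proof.
elim: n k u => [|n IHn] [|k] u kn //; rewrite ?[partial_sum _ 0]/partial_sum ?big_ord0//.
  by rewrite walk_max_ge0.
by rewrite partial_sumS/= le_max lerD2l IHn ?orbT.
Qed.

Lemma walk_max_le n u : walk_max n u <= walk_max n.+1 u.
Proof.
elim: n u => [|n IHn] u; first exact: walk_max_ge0.
by rewrite [leLHS]/= [leRHS]/= ge_max le_max lexx/= le_max lerD2l IHn orbT.
Qed.

Lemma walk_max_homo u : {homo walk_max^~ u : n m / (n <= m)%N >-> n <= m}.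
Proof. by apply: homo_leq => [//||n]; [exact: le_trans|exact: walk_max_le]. Qed.

Lemma measurable_partial_sum n :
  measurable_fun [set: @seq_space R] (fun u : @seq_space R => partial_sum u n).
Proof. by apply: measurable_sum => k; exact: measurable_coord. Qed.

Lemma measurable_shift :
  measurable_fun [set: @seq_space R] (fun u : @seq_space R => shift u : @seq_space R).
Proof.
apply: (@measurable_to_seq_space _ _ _ (fun k (u : @seq_space R) => (u : nat -> R) k.+1)).
by move=> k; exact: measurable_coord.
Qed.

Lemma measurable_walk_max n :
  measurable_fun [set: @seq_space R] (fun u : @seq_space R => walk_max n u).
Proof.
elim: n => [|n IHn]; first exact: measurable_cst.
apply: measurable_maxr => //; apply: measurable_funD; first exact: measurable_coord.
exact: measurableT_comp IHn measurable_shift.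
Qed.

Lemma measurable_walk_sup :
  measurable_fun [set: @seq_space R] (fun u : @seq_space R => walk_sup u).
Proof.
have := @measurable_fun_esups _ (@seq_space R) R setT
  (fun n u => (partial_sum u n)%:E) _ 0%N.
rewrite (_ : (fun x : @seq_space R => esups _ _) = (fun u : @seq_space R => walk_sup u)).
  by apply => n; apply/measurable_EFinP; exact: measurable_partial_sum.
apply/funext => u; rewrite /esups /sdrop /walk_sup; congr ereal_sup.
by apply/seteqP; split => _ [n _ <-]; exists n.
Qed.

End path_functionals.

(** * Almost sure finiteness of the supremum and stationarity of its law *)

Section lindley.
Context d (T : measurableType d) (R : realType) (P : probability T R)
  (xi : nat -> {RV P >-> R}) (m : R).
Hypotheses (ind : mutually_independent xi) (idd : identically_distributed xi).
Hypotheses (ixi : P.-integrable setT (EFin \o xi 0%N))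
  (Exi : ('E_P[xi 0%N] = (- m)%:E)%E) (m0 : 0 < m).
Local Notation X := (steps xi).
Local Notation X' := (steps_tail xi).
Local Notation nu := (distribution P (xi 0%N)).

Lemma ge0_integral_tail (f : @seq_space R -> \bar R) :
  measurable_fun setT f -> (forall u, 0 <= f u)%E ->
  (\int[P]_w f (X' w) = \int[P]_w f (X w))%E.
Proof.
move=> mf f0.
have := @ge0_integral_head_tail _ _ _ _ _ ind idd (f \o snd).
move=> /= -> //; last by apply: measurableT_comp => //; exact: measurable_snd.
rewrite integral_cst//.
by rewrite [X in (_ * X)%E](@probability_setT _ _ _ nu) mule1.
Qed.

Lemma integral_head_tail_prod (h : R -> R) (f : @seq_space R -> R) :
  measurable_fun setT h -> (forall s, 0 <= h s) ->
  measurable_fun setT f -> (forall u, 0 <= f u) ->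
  (\int[P]_w (h (xi 0%N w) * f (X' w))%:E =
   (\int[P]_w (h (xi 0%N w))%:E) * \int[P]_w (f (X w))%:E)%E.
Proof.
move=> mh h0 mf f0.
have := @ge0_integral_head_tail _ _ _ _ _ ind idd (fun z => (h z.1 * f z.2)%:E).
move=> -> //; last 2 first.
- apply/measurable_EFinP/measurable_funM.
    by apply: measurableT_comp => //; exact: measurable_fst.
  by apply: measurableT_comp => //; exact: measurable_snd.
- by move=> z; rewrite lee_fin mulr_ge0.
have mX := measurable_steps xi.
under eq_integral.
  move=> s _; under eq_integral do rewrite /= EFinM.
  rewrite ge0_integralZl//=.
  - over.
  - by apply/measurable_EFinP; exact: measurableT_comp mf mX.
  - by move=> w _; rewrite lee_fin.
  - by rewrite lee_fin.
rewrite ge0_integralZr//=.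
- by rewrite ge0_integral_distribution//; first exact/measurable_EFinP.
- exact/measurable_EFinP.
- by move=> s _; rewrite lee_fin.
- by apply: integral_ge0 => w _; rewrite lee_fin.
Qed.


(* On the shift-invariant event Einf that the supremum is infinite, the recursion
   M_{n+1} = max(0, xi_0 + M'_n) gives E[min(M'_n, xi_0^-)] <= E[xi_0^+]. As M'_n
   increases to +oo there and Einf is independent of xi_0 (through the shifted
   path), E[xi_0] < 0 forces Einf to be null. *)
Let Einf : set (@seq_space R) := [set u | walk_sup u = +oo%E].

Let measurable_Einf : measurable Einf.
Proof.
rewrite (_ : Einf = (fun u : @seq_space R => walk_sup u) @^-1` [set +oo%E])//.
by rewrite -[X in measurable X]setTI; exact: measurable_walk_sup.
Qed.

Let Einf_tail w : \1_Einf (X w) = \1_Einf (X' w) :> R.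
Proof.
rewrite !indicE; congr (nat_of_bool _)%:R.
apply/idP/idP; rewrite !inE /Einf/= => /eqP h; apply/eqP.
  by rewrite (walk_sup_shift_pinfty (X w)).
by rewrite -(walk_sup_shift_pinfty (X w)).
Qed.

Let pos (s : R) : R := Num.max s 0.
Let neg (s : R) : R := Num.max (- s) 0.

Let measurable_pos : measurable_fun setT pos.
Proof. exact: measurable_maxr. Qed.

Let measurable_neg : measurable_fun setT neg.
Proof. by apply: measurable_maxr => //; exact: oppr_measurable. Qed.

Let a n : \bar R := (\int[P]_w (walk_max n (X w) * \1_Einf (X w))%:E)%E.
Let b n : \bar R :=
  (\int[P]_w (Num.min (walk_max n (X' w)) (neg (xi 0%N w)) * \1_Einf (X' w))%:E)%E.
Let c : \bar R := (\int[P]_w (pos (xi 0%N w) * \1_Einf (X' w))%:E)%E.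

Let mX := measurable_steps xi.
Let mX' := measurable_steps_tail xi.
Let mXi k : measurable_fun setT (xi k : T -> R) := measurable_funPT (xi k).

Let measurable_aux n : measurable_fun [set: @seq_space R]
  (fun u : @seq_space R => walk_max n u * \1_Einf u).
Proof.
by apply: measurable_funM; [exact: measurable_walk_max|exact: measurable_indic].
Qed.

Let measurable_1X' : measurable_fun setT (fun w => \1_Einf (X' w) : R).
Proof. by apply: measurableT_comp mX' => //; exact: measurable_indic. Qed.

Let measurable_b n : measurable_fun setT (fun w =>
  Num.min (walk_max n (X' w)) (neg (xi 0%N w)) * \1_Einf (X' w)).
Proof.
apply: measurable_funM => //; apply: measurable_minr.
  exact: measurableT_comp (measurable_walk_max n) mX'.
exact: measurableT_comp measurable_neg (mXi 0).
Qed.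

Let one_ge0 u : 0 <= \1_Einf u :> R. Proof. by rewrite indicE. Qed.
Let pos_ge0 s : 0 <= pos s. Proof. by rewrite /pos le_max lexx orbT. Qed.
Let neg_ge0 s : 0 <= neg s. Proof. by rewrite /neg le_max lexx orbT. Qed.
Let b_ge0 n w : 0 <= Num.min (walk_max n (X' w)) (neg (xi 0%N w)) * \1_Einf (X' w).
Proof. by rewrite mulr_ge0// le_min walk_max_ge0 neg_ge0. Qed.

(** Integrates the identity max(0, s + y) + min(y, s^-) = y + s^+, valid for y >= 0, over the event.
    It is kept additive so that no possibly infinite term is subtracted. *)
Let drift n : (a n.+1 + b n = a n + c)%E.
Proof.
have -> : a n = (\int[P]_w (walk_max n (X' w) * \1_Einf (X' w))%:E)%E.
  apply/esym/(ge0_integral_tail (f := fun u => (walk_max n u * \1_Einf u)%:E)).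
    exact/measurable_EFinP.
  by move=> u; rewrite lee_fin mulr_ge0// walk_max_ge0.
rewrite /a /b /c -!ge0_integralD//=.
- apply: eq_integral => w _; rewrite -!EFinD Einf_tail -!mulrDl; congr (_ * _)%:E.
  rewrite /pos /neg -[shift _]/(X' w) -[X w 0%N]/(xi 0%N w).
  have := walk_max_ge0 n (X' w); move: (walk_max _ _) (xi 0%N w) => x y x0.
  rewrite /Num.max /Num.min; case: (ltP (- y) 0) => ?; case: (ltP y 0) => ?;
    case: (ltP 0 (y + x)) => ?; case: ltP => ?; lra.
- by move=> w _; rewrite lee_fin mulr_ge0// walk_max_ge0.
- apply/measurable_EFinP; exact: measurableT_comp (measurable_aux n) mX'.
- by move=> w _; rewrite lee_fin mulr_ge0.
- apply/measurable_EFinP/measurable_funM => //.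
  exact: measurableT_comp measurable_pos (mXi 0).
- by move=> w _; rewrite lee_fin mulr_ge0// (walk_max_ge0 n.+1).
- apply/measurable_EFinP; exact: measurableT_comp (measurable_aux n.+1) mX.
- by move=> w _; rewrite lee_fin.
- exact/measurable_EFinP.
Qed.

Let Ipos : \bar R := (\int[P]_w (pos (xi 0%N w))%:E)%E.
Let Ineg : \bar R := (\int[P]_w (neg (xi 0%N w))%:E)%E.
Let Eprob : \bar R := P (X @^-1` Einf).

Let cE : c = (Ipos * Eprob)%E.
Proof.
rewrite /c (integral_head_tail_prod (f := \1_Einf))//.
congr (_ * _)%E; rewrite -[LHS]/(\int[P]_w (\1_(X @^-1` Einf) w)%:E)%E integral_indic//.
  by rewrite setIT.
by rewrite -[X in measurable X]setTI; exact: mX.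
Qed.

Let negE : (\int[P]_w (neg (xi 0%N w) * \1_Einf (X' w))%:E = Ineg * Eprob)%E.
Proof.
rewrite (integral_head_tail_prod (f := \1_Einf))//.
congr (_ * _)%E; rewrite -[LHS]/(\int[P]_w (\1_(X @^-1` Einf) w)%:E)%E integral_indic//.
  by rewrite setIT.
by rewrite -[X in measurable X]setTI; exact: mX.
Qed.

Let Ipos_fin : Ipos \is a fin_num.
Proof.
have := integrable_pos_fin_num measurableT ixi; congr (_ \is a fin_num).
by apply: eq_integral => w _; rewrite funeposE/= -EFin_max.
Qed.

Let Ineg_fin : Ineg \is a fin_num.
Proof.
have := integrable_neg_fin_num measurableT ixi; congr (_ \is a fin_num).
by apply: eq_integral => w _; rewrite funenegE/= -EFin_max.
Qed.

Let IposB : (Ipos - Ineg = (- m)%:E)%E.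
Proof.
rewrite -Exi unlock integralE; congr (_ - _)%E.
  by apply: eq_integral => w _; rewrite funeposE/= -EFin_max.
by apply: eq_integral => w _; rewrite funenegE/= -EFin_max.
Qed.

Let Eprob_fin : Eprob \is a fin_num.
Proof.
by apply: fin_num_measure; rewrite -[X in measurable X]setTI; exact: mX.
Qed.

Let a_ge0 n : (0 <= a n)%E.
Proof.
by apply: integral_ge0 => w _; rewrite lee_fin mulr_ge0// walk_max_ge0.
Qed.

(** By induction [drift] bounds [a n.+1] by [a n + c]. Finiteness is what allows [a n] to be
    cancelled in [b_le]. *)
Let a_fin n : a n \is a fin_num.
Proof.
elim: n => [|n IHn].
  by rewrite /a (_ : integral _ _ _ = 0%E)//; apply: integral0_eq => w _; rewrite mul0r.
have : (a n + c)%E \is a fin_num by rewrite fin_numD IHn cE fin_numM.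
rewrite !ge0_fin_numE// -?drift; last by rewrite adde_ge0//; apply: integral_ge0 => *; rewrite lee_fin.
by apply: le_lt_trans; rewrite leeDl//; apply: integral_ge0 => *; rewrite lee_fin.
Qed.

Let b_le n : (b n <= c)%E.
Proof.
rewrite -(@leeD2lE _ (a n))// -drift leeD2r//.
apply: ge0_le_integral => //.
- by move=> w _; rewrite lee_fin mulr_ge0// walk_max_ge0.
- by apply/measurable_EFinP; exact: measurableT_comp (measurable_aux n) mX.
- by apply/measurable_EFinP; exact: measurableT_comp (measurable_aux n.+1) mX.
- by move=> w _; rewrite lee_fin ler_wpM2r// walk_max_le.
Qed.

Lemma walk_sup_finite : P [set w | walk_sup (X w) = +oo%E] = 0%E.
Proof.
rewrite -[LHS]/Eprob.
have : (Ineg * Eprob <= Ipos * Eprob)%E.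
  rewrite -cE -negE.
  pose g n w := (Num.min (walk_max n (X' w)) (neg (xi 0%N w)) * \1_Einf (X' w))%:E.
  have -> : (\int[P]_w (neg (xi 0%N w) * \1_Einf (X' w))%:E =
             \int[P]_w limn (g ^~ w))%E.
    apply: eq_integral => w _; apply/esym/cvg_lim => //.
    (* Off the event every term is 0; on it the sequence is constant once some partial sum has
       passed the negative part of the first step. *)
    apply: cvg_near_cst; rewrite /g indicE.
    case: (boolP (X' w \in Einf)) => [|_]; last by apply: nearW => n; rewrite !mulr0.
    rewrite inE /Einf/= => supE.
    have [N hN] : exists N, neg (xi 0%N w) <= partial_sum (X' w) N.
      apply: contrapT => /forallNP h.
      have : (walk_sup (X' w) <= (neg (xi 0%N w))%:E)%E.
        apply: ge_ereal_sup => _ [n _ <-]; rewrite lee_fin.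
        by apply/ltW; rewrite ltNge; apply/negP.
      by rewrite supE.
    exists N => // n /= Nn; congr (_ * _)%:E; apply/min_idPr.
    exact: le_trans hN (partial_sum_le_max _ _).
  have h : (\int[P]_w g n w @[n --> \oo] --> \int[P]_w limn (g ^~ w))%E.
    apply: cvg_monotone_convergence => //.
    - by move=> n; exact/measurable_EFinP.
    - by move=> n w _; rewrite lee_fin.
    - move=> w _ n k nk; rewrite lee_fin ler_wpM2r// le_min !ge_min lexx orbT andbT.
      by rewrite walk_max_homo.
  rewrite -(cvg_lim _ h)//; apply: lime_le; first exact: cvgP h.
  by apply: nearW => n; exact: b_le.
move: IposB; rewrite -(fineK Ipos_fin) -(fineK Ineg_fin) -(fineK Eprob_fin).
have : 0 <= fine Eprob by exact: fine_ge0 (measure_ge0 _ _).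
move: (fine Ipos) (fine Ineg) (fine Eprob) => i j e e0.
rewrite -EFinB -!EFinM lee_fin => -[h1] h2; apply/eqP; rewrite eqe; apply/eqP.
have : m * e <= 0 by rewrite (_ : m = j - i) ?mulrBl; lra.
by rewrite pmulr_rle0// => ?; apply/eqP; rewrite eq_le e0 andbT.
Qed.


Let measurable_fine_sup :
  measurable_fun setT (fun u : @seq_space R => fine (walk_sup u)).
Proof.
apply: (measurableT_comp (f := fine) (g := fun u : @seq_space R => walk_sup u)).
  exact: fine_measurable.
exact: measurable_walk_sup.
Qed.

Lemma measurable_rwalk_sup : measurable_fun setT (rwalk_sup xi).
Proof. exact: measurableT_comp measurable_fine_sup mX. Qed.

Lemma rwalk_sup_ge0 w : 0 <= rwalk_sup xi w.
Proof. exact: fine_ge0 (walk_sup_ge0 (X w)). Qed.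

Lemma lindley_equation (f : R -> \bar R) :
  measurable_fun setT f -> (forall y, 0 <= f y)%E ->
  (\int[P]_w f (rwalk_sup xi w) =
   \int[nu]_s \int[P]_w f (Num.max 0 (s + rwalk_sup xi w))%R)%E.
Proof.
move=> mf f0.
have mstep : measurable_fun [set: R * @seq_space R]
    (fun z : R * @seq_space R => f (Num.max 0 (z.1 + fine (walk_sup z.2)))).
  apply: measurableT_comp => //; apply: measurable_maxr => //.
  apply: measurable_funD; first exact: measurable_fst.
  exact: measurableT_comp measurable_fine_sup measurable_snd.
have mpair : measurable_fun [set: T] (fun w => (xi 0%N w : R, X' w)).
  by apply/measurable_fun_pair => //; exact: mXi.
rewrite -(ge0_integral_head_tail ind idd mstep)//=.
apply: ge0_ae_eq_integral => //.
- by apply: measurableT_comp => //; exact: measurable_rwalk_sup.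
- exact: measurableT_comp mstep mpair.
(* Off this null event both suprema are real and [fine] commutes with the recursion [walk_supE]. *)
exists (X @^-1` Einf); split => //.
- by rewrite -[X in measurable X]setTI; exact: mX.
- exact: walk_sup_finite.
move=> w /= /not_implyP[_ h]; apply: contrapT => fin; apply: h; congr f.
have : walk_sup (X w) != +oo%E by apply/eqP.
have := walk_supE (X w).
rewrite -walk_sup_shift_pinfty -[shift _]/(X' w).
have := walk_sup_ge0 (X' w).
rewrite -[rwalk_sup xi w]/(fine (walk_sup (X w))) => + ->.
by case: (walk_sup (X' w)) => [r||]//= _ _; rewrite -EFinD -EFin_max.
Qed.

End lindley.

(** * Tails and interval masses of a probability on the line *)

Section tail_mass.
Context {R : realType}.
Implicit Types (mu : probability R R) (x y a b c : R).

Definition tail mu x : R := fine (mu `]x, +oo[%classic).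
Definition mass mu a b : R := fine (mu `]a, b]%classic).

Lemma tailE mu x : (tail mu x)%:E = mu `]x, +oo[%classic.
Proof. by rewrite fineK// fin_num_measure. Qed.

Lemma massE mu a b : (mass mu a b)%:E = mu `]a, b]%classic.
Proof. by rewrite fineK// fin_num_measure. Qed.

Lemma tail_ge0 mu x : 0 <= tail mu x.
Proof. exact: fine_ge0. Qed.

Lemma tail_le1 mu x : tail mu x <= 1.
Proof. by rewrite -lee_fin tailE probability_le1. Qed.

Lemma tail_anti mu x y : x <= y -> tail mu y <= tail mu x.
Proof.
move=> xy; rewrite -lee_fin !tailE le_measure ?inE//.
by apply: subset_itvr; rewrite bnd_simp.
Qed.

Lemma measurable_tail mu : measurable_fun setT (tail mu).
Proof. by apply: nonincreasing_measurable => // x y; exact: tail_anti. Qed.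

Lemma mass_ge0 mu a b : 0 <= mass mu a b.
Proof. exact: fine_ge0. Qed.

Lemma mass_sub mu a b a' b' : a' <= a -> b <= b' -> mass mu a b <= mass mu a' b'.
Proof.
move=> aa bb; rewrite -lee_fin !massE le_measure ?inE//.
by apply: subset_itv; rewrite bnd_simp.
Qed.

Lemma mass_split_le mu a b c : mass mu a c <= mass mu a b + mass mu b c.
Proof.
rewrite -lee_fin EFinD !massE; apply: le_trans (measureU2 _ _ _) => //.
rewrite le_measure ?inE//; first exact: measurableU.
move=> x /=; rewrite !in_itv/= => /andP[ax xc].
by case: (leP x b) => xb; [left|right]; rewrite ?ax ?xb.
Qed.

Lemma mass_split mu a b c : a <= b -> b <= c ->
  mass mu a c = mass mu a b + mass mu b c.
Proof.
move=> ab bc; apply: EFin_inj; rewrite EFinD !massE -measureU//; last first.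
  by apply/seteqP; split => x //= -[]; rewrite !in_itv/= => /andP[_ +] /andP[+ _]; lra.
congr (mu _); apply/seteqP; split => x /=; rewrite !in_itv/=.
  by case: (leP x b) => xb /andP[-> ->]; [left|right].
by case=> /andP[h1 h2]; apply/andP; split; lra.
Qed.

Lemma sum_mass mu x (h : R) (n : nat) : 0 <= h ->
  \sum_(0 <= i < n) mass mu (x + i%:R * h) (x + i.+1%:R * h) =
  mass mu x (x + n%:R * h).
Proof.
move=> h0; elim: n => [|n IHn].
  rewrite big_nil mul0r addr0; apply: EFin_inj.
  by rewrite massE set_itvxx ?measure0// set_itvoc0.
rewrite big_nat_recr//= IHn -mass_split// ?lerD2l ?ler_wpM2r ?ler_nat//.
by rewrite lerDl mulr_ge0.
Qed.

End tail_mass.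

Section long_tail.
Context {R : realType} (nu : probability R R).
Local Notation Fb := (tail nu).
Hypotheses (Fpos : forall x, 0 < Fb x)
  (LT : forall c, 0 < c -> Fb (x - c) / Fb x @[x --> +oo] --> (1 : R)).

Lemma near_pinftyD (c : R) (Q : R -> Prop) :
  (\forall x \near +oo, Q x) -> \forall x \near +oo, Q (x + c).
Proof.
move=> [M [Mr HM]]; exists (M - c); split; first exact: num_real.
by move=> x Mx; apply: HM; lra.
Qed.

Lemma long_tailB (c e : R) : 0 <= c -> 0 < e ->
  \forall x \near +oo, Fb (x - c) <= (1 + e) * Fb x.
Proof.
rewrite le_eqVlt => /predU1P[<-|c0] e0.
  near=> x; rewrite subr0 ler_peMl ?tail_ge0//; lra.
have : \forall x \near +oo, Fb (x - c) / Fb x < 1 + e.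
  by apply: (cvgr_lt (1 : R) (LT c0)); rewrite ltrDl.
by apply: filterS => x; rewrite ltr_pdivrMr// => /ltW.
Unshelve. all: by end_near. Qed.

Lemma long_tailD (c e : R) : 0 <= c -> 0 < e ->
  \forall x \near +oo, Fb x <= (1 + e) * Fb (x + c).
Proof.
move=> c0 e0; have := near_pinftyD c (long_tailB c0 e0).
by apply: filterS => x; rewrite addrK.
Qed.

End long_tail.

(* No measurability is needed: the integral of a nonnegative function is the
   supremum of the integrals of the simple functions below it. *)
Lemma ge0_le_lower_integral d (T : measurableType d) (R : realType)
    (mu : {measure set T -> \bar R}) (D : set T) (f1 f2 : T -> \bar R) :
  (forall x, D x -> 0 <= f1 x)%E -> (forall x, D x -> f1 x <= f2 x)%E ->
  (\int[mu]_(x in D) f1 x <= \int[mu]_(x in D) f2 x)%E.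
Proof.
move=> f10 f12; have f20 x : D x -> (0 <= f2 x)%E.
  by move=> Dx; exact: le_trans (f10 x Dx) (f12 x Dx).
rewrite !ge0_integralE//; apply: le_ereal_sup => _ [h hf1 <-].
exists h => // x; apply: le_trans (hf1 x) _.
by rewrite /patch; case: ifPn => //; rewrite inE; exact: f12.
Qed.

(** * Consequences of direct Riemann integrability *)

Section riemann_sums.
Context {R : realType} (g : R -> R).
Hypothesis gG : classG g.

Let g0 t : 0 <= t -> 0 <= g t. Proof. by case: gG => + _; apply. Qed.

Let cell (h : R) (k : nat) : set R := `[k%:R * h, k.+1%:R * h]%classic.

Let cell_ge0 (h : R) k t : 0 < h -> cell h k t -> 0 <= t.
Proof.
move=> h0; rewrite /cell/= in_itv/= => /andP[+ _]; apply: le_trans.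
by rewrite mulr_ge0// ltW.
Qed.

Let cell_left (h : R) k : 0 < h -> cell h k (k%:R * h).
Proof. by move=> h0; rewrite /cell/= in_itv/= lexx ler_pM2r// ler_nat leqnSn. Qed.

Let csup (h : R) k : \bar R := ereal_sup [set (g t)%:E | t in cell h k].
Let cinf (h : R) k : \bar R := ereal_inf [set (g t)%:E | t in cell h k].

Let csup_ge (h : R) k t : cell h k t -> ((g t)%:E <= csup h k)%E.
Proof. by move=> ht; apply: ereal_sup_ubound; exists t. Qed.

Let csup_ge0 (h : R) k : 0 < h -> (0 <= csup h k)%E.
Proof.
move=> h0; apply: le_trans (csup_ge (cell_left k h0)).
by rewrite lee_fin g0// (cell_ge0 h0 (cell_left k h0)).
Qed.

Let cinf_ge0 (h : R) k : 0 < h -> (0 <= cinf h k)%E.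
Proof.
move=> h0; apply: le_ereal_inf_tmp => _ [t ht <-].
by rewrite lee_fin g0// (cell_ge0 h0 ht).
Qed.

Let cinf_le (h : R) k t : cell h k t -> (cinf h k <= (g t)%:E)%E.
Proof. by move=> ht; apply: ereal_inf_lbound; exists t. Qed.

Let cinf_fin (h : R) k : 0 < h -> cinf h k \is a fin_num.
Proof.
move=> h0; rewrite ge0_fin_numE ?cinf_ge0//.
exact: le_lt_trans (cinf_le (cell_left k h0)) (ltry _).
Qed.

(** The step function equal to [csup h k] on the k-th cell dominates g and integrates term by term
    to the upper sum. *)
Lemma integral_le_dR_upper (h : R) : 0 < h ->
  (\int[lebesgue_measure]_(t in `[0%R, +oo[) (g t)%:E <= dR_upper g h)%E.
Proof.
move=> h0.
pose F k : set R := `[k%:R * h, k.+1%:R * h[%classic.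
pose u t := (\sum_(0 <= k <oo) csup h k * (\1_(F k) t)%:E)%E.
have u0 k t : (0 <= csup h k * (\1_(F k) t)%:E)%E by rewrite mule_ge0 ?csup_ge0.
apply: (@le_trans _ _ (\int[lebesgue_measure]_(t in `[0%R, +oo[) u t)%E).
  apply: ge0_le_lower_integral => t /=; rewrite in_itv/= andbT => t0.
    by rewrite lee_fin g0.
  pose k := Num.truncn (t / h).
  have Ft : F k t.
    rewrite /F/= in_itv/= -ler_pdivlMr// -ltr_pdivrMr//.
    by rewrite truncn_le ?divr_ge0 ?truncnS_gt//= ltW.
  have Ct : cell h k t.
    by move: Ft; rewrite /F /cell/= !in_itv/= => /andP[-> /ltW].
  apply: (@le_trans _ _ (csup h k * (\1_(F k) t)%:E)%E).
    by rewrite indicE mem_set// mule1 csup_ge.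
  apply: le_trans (nneseries_lim_ge k.+1 _) => //.
  by rewrite big_nat_recr//= leeDr// sume_ge0.
rewrite integral_nneseries//; last first.
  by move=> k; apply: measurable_funeM; apply/measurable_EFinP/measurable_indic; exact: measurable_itv.
apply: lee_nneseries => k _ //; first by move=> _; apply: integral_ge0.
rewrite ge0_integralZl ?csup_ge0//; last first.
  by apply/measurable_EFinP/measurable_indic; exact: measurable_itv.
rewrite muleC; apply: lee_wpmul2r; first exact: csup_ge0.
have mF : measurable (F k) by exact: measurable_itv.
rewrite integral_indic//; apply: (@le_trans _ _ (lebesgue_measure (F k))).
  by apply: le_measure; rewrite ?inE//; exact: measurableI.
rewrite lebesgue_measure_itv/= lte_fin ltr_pM2r// ltr_nat ltnSn.
by rewrite -EFinB lee_fin -mulrBl -natr1 addrAC subrr add0r mul1r.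
Qed.

(** The common limit l serves on both sides: it bounds the integral in the limit hypothesis from
    above, and it is nearly attained by the area of a finite step function below g. The two
    occurrences of l cancel in [mass_upper_bound]. *)
Lemma dRi_limit : exists l : R,
  [/\ (\int[lebesgue_measure]_(t in `[0%R, +oo[) (g t)%:E <= l%:E)%E &
   forall e, 0 < e -> e < l -> exists (h : R) (K : nat) (a : nat -> R),
    [/\ 0 < h, forall k, 0 <= a k,
      forall k t, k%:R * h <= t <= k.+1%:R * h -> a k <= g t &
      l - e <= h * \sum_(k < K) a k]].
Proof.
have [_ [gfin [l [lu ll]]]] := gG.
exists l; split.
  set I := integral _ _ _.
  have I0 : (0 <= I)%E.
    by apply: integral_ge0 => t /=; rewrite in_itv/= andbT lee_fin => /g0.
  have Ifin : I \is a fin_num.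
    by rewrite ge0_fin_numE// (le_lt_trans (integral_le_dR_upper ltr01)) ?gfin.
  rewrite -(fineK Ifin) lee_fin.
  rewrite -(cvg_lim _ lu)//; apply: limr_ge; first exact: cvgP lu.
  near=> h; have h0 : 0 < h by near: h; exact: nbhs_right_gt.
  rewrite fine_le ?integral_le_dR_upper//.
  rewrite ge0_fin_numE ?gfin//; exact: le_trans I0 (integral_le_dR_upper h0).
move=> e e0 el.
have : \forall h \near 0^'+, l - e < fine (dR_lower g h).
  by apply: (cvgr_gt l ll); rewrite ltrBlDr ltrDl.
have hp : \forall h \near (0 : R)^'+, 0 < h by exact: nbhs_right_gt.
move=> /(filterI hp)/filter_ex[h [h0 lh]].
(* [fine] is 0 at -oo, and [e < l] makes this default value incompatible with the lower bound. *)
have dl : ((l - e)%:E < dR_lower g h)%E.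
  move: lh; case: (dR_lower g h) => [r||]//=; rewrite ?lte_fin ?ltry//.
  by rewrite subr_lt0 => /(lt_trans el); rewrite ltxx.
have cvgl : (\sum_(0 <= k < n) h%:E * cinf h k)%E @[n --> \oo] --> dR_lower g h.
  apply: is_cvg_nneseries => n _ _.
  by rewrite mule_ge0 ?cinf_ge0// lee_fin ltW.
have : \forall n \near \oo, ((l - e)%:E < \sum_(0 <= k < n) h%:E * cinf h k)%E.
  exact: (cvgl _ (open_ereal_gt' dl)).
move=> /filter_ex[K hK].
exists h, K, (fun k => fine (cinf h k)); split => //.
- by move=> k; rewrite fine_ge0// cinf_ge0.
- move=> k t tk; rewrite -lee_fin fineK ?cinf_fin//.
  by apply: cinf_le; rewrite /cell/= in_itv.
- rewrite -lee_fin mulr_sumr -sumEFin; apply: (le_trans (ltW hK)).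
  rewrite big_mkord; apply: lee_sum => k _.
  by rewrite EFinM fineK ?cinf_fin.
Unshelve. all: by end_near. Qed.

End riemann_sums.

Lemma cvge_near_lt {R : realType} (f : R -> \bar R) (y z : \bar R) :
  f x @[x --> +oo] --> y -> (y < z)%E -> \forall x \near +oo, (f x < z)%E.
Proof. by move=> fy yz; exact: (fy _ (open_ereal_lt' yz)). Qed.

(** * Upper bounds for the mass of a window under [pi] *)

Section local_mass.
Context {R : realType} (pi nu : probability R R) (g : R -> R) (m : R).
Local Notation Fb := (tail nu).
Hypotheses (Fpos : forall x, 0 < Fb x)
  (LT : forall c, 0 < c -> Fb (x - c) / Fb x @[x --> +oo] --> (1 : R))
  (m0 : 0 < m) (gG : classGstar g).

Let G x : \bar R := (\int[pi]_(y in `]x, +oo[) (g (y - x))%:E)%E.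

Hypothesis limG : (G x / (Fb x)%:E)%E @[x --> +oo] -->
  ((m^-1)%:E * \int[lebesgue_measure]_(t in `[0%R, +oo[) (g t)%:E)%E.

Let g0 t : 0 <= t -> 0 <= g t. Proof. by case: gG => -[+ _] _; apply. Qed.

Let block (h x : R) (k : nat) : set R := `]x + k%:R * h, x + k.+1%:R * h]%classic.

Let block_disjoint (h x y : R) (j k : nat) : 0 < h ->
  block h x j y -> block h x k y -> j = k.
Proof.
move=> h0; rewrite /block/= !in_itv/= => /andP[j1 j2] /andP[k1 k2].
have aux (i i' : nat) : x + i%:R * h < y -> y <= x + i'.+1%:R * h -> (i <= i')%N.
  move=> h1 h2; rewrite -ltnS -(ltr_nat R) -(ltr_pM2r h0).
  by rewrite -(ltrD2l x); exact: lt_le_trans h1 h2.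
by apply/eqP; rewrite eqn_leq !aux.
Qed.

(** The blocks are disjoint, so at each point the sum of weighted indicators has at most one nonzero
    term, and this term lies below g(y - x). *)
Let step_le_G (h : R) (K : nat) (a : nat -> R) x : 0 < h -> (forall k, 0 <= a k) ->
  (forall k t, (k < K)%N -> k%:R * h < t <= k.+1%:R * h -> a k <= g t) ->
  ((\sum_(k < K) a k * mass pi (x + k%:R * h) (x + k.+1%:R * h))%:E <= G x)%E.
Proof.
move=> h0 a0 ag.
have mB k : measurable (block h x k) by exact: measurable_itv.
have subB k : block h x k `<=` `]x, +oo[.
  move=> y; rewrite /block/= !in_itv/= => /andP[+ _]; rewrite andbT; apply: le_lt_trans.
  by rewrite lerDl mulr_ge0// ltW.
apply: (@le_trans _ _ (\int[pi]_(y in `]x, +oo[)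
    \sum_(k < K) (a k * \1_(block h x k) y)%:E)%E).
  rewrite ge0_integral_sum//; last 2 first.
    by move=> k; apply/measurable_EFinP/measurable_funM => //; exact: measurable_indic.
    by move=> k y _; rewrite lee_fin mulr_ge0.
  rewrite -sumEFin; apply: lee_sum => k _.
  rewrite EFinM massE.
  under eq_integral do rewrite EFinM.
  rewrite ge0_integralZl//; last 2 first.
    by apply/measurable_EFinP; exact: measurable_indic.
    by rewrite lee_fin.
  by rewrite integral_indic// setIidl.
apply: ge0_le_lower_integral => y /=; rewrite in_itv/= andbT => xy.
  by rewrite sume_ge0// => k _; rewrite lee_fin mulr_ge0.
rewrite sumEFin lee_fin.
have [[j yj]|nex] := pselect (exists j : 'I_K, block h x j y).
  rewrite (bigD1 j)//= big1 ?addr0.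
    rewrite indicE mem_set// mulr1; apply: ag => //.
    by move: yj; rewrite /block/= in_itv/= ltrBrDl lerBlDl.
  move=> k kj; rewrite indicE memNset ?mulr0// => yk.
  by move/eqP: kj; apply; apply: val_inj; exact: block_disjoint yk yj.
rewrite big1 ?g0 ?subr_ge0 ?(ltW xy)// => k _.
by rewrite indicE memNset ?mulr0// => yk; apply: nex; exists k.
Qed.

Let G_upper (l e : R) : (\int[lebesgue_measure]_(t in `[0%R, +oo[) (g t)%:E <= l%:E)%E ->
  0 < e -> \forall x \near +oo, (G x <= ((l / m + e) * Fb x)%:E)%E.
Proof.
move=> Il e0; have limG' := limG; move: Il limG'; set I := integral _ _ _ => Il limG'.
have I_lt : ((m^-1)%:E * I < (l / m + e)%:E)%E.
  apply: (@le_lt_trans _ _ ((m^-1)%:E * l%:E)%E).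
    by rewrite lee_wpmul2l// lee_fin invr_ge0 ltW.
  by rewrite -EFinM lte_fin mulrC ltrDl.
have := cvge_near_lt limG' I_lt; apply: filterS => x /=.
by rewrite inver gt_eqF// lte_pdivrMr// EFinM => /ltW.
Qed.

(** As g >= c on [a, b], the mass of ]x + a, x + b] is at most G x / c. Long-tailedness removes the
    shift by a at the cost of a factor 2, and ]x, x + u] is covered by at most u / h + 1 intervals
    of length h = b - a. Monotonicity of Fb makes the threshold [x0] uniform in u. *)
Lemma mass_linear_bound : exists C x0, 0 < C /\
  forall x u, x0 <= x -> 0 <= u -> mass pi x (x + u) <= C * (u + 1) * Fb x.
Proof.
have [gG' [a [b [c [a0 ab c0 gc]]]]] := gG.
have [l [Il _]] := dRi_limit gG'.
pose h := b - a; have h0 : 0 < h by rewrite subr_gt0.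
have step x : ((c * mass pi (x + a) (x + b))%:E <= G x)%E.
  apply: (@le_trans _ _ (\int[pi]_(y in `]x, +oo[) (c * \1_(`]x + a, x + b]%classic) y)%:E)%E).
    under eq_integral do rewrite EFinM.
    rewrite ge0_integralZl//; last 2 first.
      by apply/measurable_EFinP; exact: measurable_indic.
      by rewrite lee_fin ltW.
    rewrite integral_indic// setIidl ?EFinM ?massE//.
    by move=> y /=; rewrite !in_itv/= => /andP[+ _]; rewrite andbT; lra.
  apply: ge0_le_lower_integral => y /=; rewrite in_itv/= andbT => xy.
    by rewrite lee_fin mulr_ge0// ltW.
  rewrite lee_fin indicE; case: (boolP (y \in _)) => [|_]; last first.
    by rewrite mulr0 g0// subr_ge0 ltW.
  by rewrite inE/= in_itv/= mulr1 => /andP[? ?]; apply: gc; apply/andP; split; lra.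
(* The sign of l is not established here; the maximum with 1 makes the constant positive. *)
pose C1 := Num.max (l / m + 1) 1.
have C10 : 0 < C1 by rewrite lt_max ltr01 orbT.
have : \forall x \near +oo, mass pi x (x + h) <= (2 * C1 / c) * Fb x.
  have Gu : \forall x \near +oo, mass pi (x + a) (x + b) <= C1 / c * Fb x.
    have := G_upper Il ltr01; apply: filterS => x /(le_trans (step x)).
    rewrite lee_fin => H; rewrite mulrAC ler_pdivlMr// mulrC (le_trans H)//.
    by rewrite ler_wpM2r ?tail_ge0// le_max lexx.
  have := near_pinftyD (- a) Gu; have := long_tailB Fpos LT a0 (ltr01 : (0 : R) < 1).
  apply: filterS2 => x H1; rewrite subrK (_ : x - a + b = x + h); last by rewrite /h; ring.
  move=> /le_trans; apply.
  rewrite (_ : 2 * C1 / c * Fb x = C1 / c * (2 * Fb x)); last by ring.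
  by rewrite ler_wpM2l// divr_ge0// ltW.
move=> [M [_ HM]].
pose C2 := 2 * C1 / c; have C20 : 0 < C2 by rewrite /C2 divr_gt0// mulr_gt0.
exists (C2 * (h^-1 + 1)), (M + 1); split.
  by rewrite mulr_gt0// addr_gt0// invr_gt0.
move=> x u Mx u0.
pose n := (Num.truncn (u / h)).+1.
have un : u <= n%:R * h by rewrite -ler_pdivrMr// ltW// truncnS_gt.
have nu' : n%:R <= u / h + 1.
  by rewrite /n -natr1 lerD2r truncn_le divr_ge0// ltW.
apply: (@le_trans _ _ (mass pi x (x + n%:R * h))); first by rewrite mass_sub ?lerD2l.
rewrite -sum_mass; last exact: ltW.
apply: (@le_trans _ _ (\sum_(0 <= i < n) C2 * Fb x)).
  rewrite !big_mkord; apply: ler_sum => i _.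
  have xi : x <= x + i%:R * h by rewrite lerDl mulr_ge0// ltW.
  rewrite (_ : x + i.+1%:R * h = (x + i%:R * h) + h); last by rewrite -natr1; ring.
  apply: le_trans (HM _ _) _; first by lra.
  by rewrite ler_wpM2l ?tail_anti// ltW.
rewrite sumr_const_nat subn0 -mulr_natr mulrAC ler_wpM2r ?tail_ge0//.
rewrite -mulrA ler_wpM2l ?(ltW C20)//; apply: le_trans nu' _.
have hV : 0 < h^-1 by rewrite invr_gt0.
by rewrite mulrDl mul1r mulrDr mulr1 (mulrC u); lra.
Qed.

(** With W the sum of the weights, the translates give W pi]x + K h, x + N h] <= N (1 + dl) (l / m)
    Fb x. Since h W >= (1 - dl) l and N h <= L + h, the factor l cancels. The first K cells cost an
    amount independent of L, by [mass_linear_bound]. *)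
Lemma mass_upper_bound (eps : R) : 0 < eps -> exists L0, 0 < L0 /\
  forall L, L0 <= L ->
  \forall x \near +oo, mass pi x (x + L) <= (1 + eps) * (L / m) * Fb x.
Proof.
move=> eps0.
have [gG' [a [b [c [a0 ab c0 gc]]]]] := gG.
have [l [Il approx]] := dRi_limit gG'.
have l0 : 0 < l.
  rewrite -lte_fin; apply: lt_le_trans Il.
  apply: (@lt_le_trans _ _ (\int[lebesgue_measure]_(t in `[0%R, +oo[)
      (c * \1_(`[a, b]%classic) t)%:E)%E).
    under eq_integral do rewrite EFinM.
    rewrite ge0_integralZl//; last 2 first.
      by apply/measurable_EFinP; exact: measurable_indic.
      by rewrite lee_fin ltW.
    rewrite integral_indic// setIidl.
      rewrite [X in (_ * X)%E](_ : _ = lebesgue_measure `[a, b]%classic)//.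
      rewrite lebesgue_measure_itv/= lte_fin ab -EFinB -EFinM lte_fin mulr_gt0//.
      by rewrite subr_gt0.
    by move=> y /=; rewrite !in_itv/= => /andP[+ _]; rewrite andbT; lra.
  apply: ge0_le_lower_integral => t /=; rewrite in_itv/= andbT => t0.
    by rewrite lee_fin mulr_ge0// ltW.
  rewrite lee_fin indicE; case: (boolP (t \in _)) => [|_]; last first.
    by rewrite mulr0 g0.
  by rewrite inE/= in_itv/= mulr1; exact: gc.
(* Both bounds on [dl] together give 1 + dl <= (1 + eps / 2) (1 - dl). *)
pose dl := Num.min (1 / 2) (eps / 8).
have dl0 : 0 < dl by rewrite lt_min; apply/andP; split; lra.
have dl1 : dl <= 1 / 2 by rewrite ge_min lexx.
have dl2 : dl <= eps / 8 by rewrite ge_min lexx orbT.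
have [h [K [w [h0 w0 wg lw]]]] : exists (h : R) (K : nat) (w : nat -> R),
    [/\ 0 < h, forall k, 0 <= w k,
      forall k t, k%:R * h <= t <= k.+1%:R * h -> w k <= g t &
      l - dl * l <= h * \sum_(k < K) w k].
  by apply: approx; [exact: mulr_gt0|nra].
set W := \sum_(k < K) w k in lw.
have W0 : 0 < W by rewrite -(pmulr_rgt0 _ h0); apply: lt_le_trans lw; nra.
have [C [x0 [C0 HC]]] := mass_linear_bound.
(* Chosen so that L0 eps / (2 m) equals the costs that do not grow with L: the first K cells, and
   the rounding of L up to N h. *)
pose L0 := (C * (K%:R * h + 1) + h * (1 + eps / 2) / m) * (2 * m / eps).
have L00 : 0 < L0.
  rewrite mulr_gt0//; last by rewrite divr_gt0// mulr_gt0.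
  rewrite addr_gt0//; first by rewrite mulr_gt0// ltr_wpDl// mulr_ge0// ltW.
  by rewrite divr_gt0// mulr_gt0//; lra.
exists L0; split => // L LL.
have L0' : 0 < L by exact: lt_le_trans LL.
pose N := (Num.truncn (L / h)).+1.
have LN : L <= N%:R * h by rewrite -ler_pdivrMr// ltW// truncnS_gt.
have NL : N%:R * h <= L + h.
  rewrite -(@ler_pM2r _ h^-1) ?invr_gt0// mulfK ?gt_eqF// mulrDl mulfV ?gt_eqF//.
  by rewrite /N -natr1 lerD2r truncn_le divr_ge0// ltW.
have key : \forall x \near +oo,
    W * mass pi (x + K%:R * h) (x + N%:R * h) <= N%:R * ((1 + dl) * (l / m) * Fb x).
  have dlm : 0 < dl * (l / m) by rewrite mulr_gt0// divr_gt0.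
  have [M [_ HM]] := G_upper Il dlm.
  near=> x.
  have xM : M < x by near: x; apply: nbhs_pinfty_gt; exact: num_real.
  have Gx (j : nat) : (G (x + j%:R * h)%R <= ((1 + dl) * (l / m) * Fb x)%:E)%E.
    have xj : x <= x + j%:R * h by rewrite lerDl mulr_ge0// ltW.
    apply: le_trans (HM _ (lt_le_trans xM xj)) _.
    rewrite lee_fin (_ : l / m + dl * (l / m) = (1 + dl) * (l / m)); last by ring.
    rewrite ler_wpM2l ?tail_anti// mulr_ge0 ?divr_ge0// ?ltW//; lra.
  pose q i := mass pi (x + i%:R * h) (x + i.+1%:R * h).
  have Gq j : \sum_(k < K) w k * q (j + k)%N <= (1 + dl) * (l / m) * Fb x.
    rewrite -lee_fin; apply: le_trans (Gx j).
    have -> : \sum_(k < K) w k * q (j + k)%N =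
        \sum_(k < K) w k * mass pi (x + j%:R * h + k%:R * h) (x + j%:R * h + k.+1%:R * h).
      by apply: eq_bigr => k _; rewrite /q -!natr1 !natrD; congr (_ * mass _ _ _); ring.
    by apply: step_le_G => // k t _ /andP[/ltW t1 t2]; apply: wg; rewrite t1.
  (* After exchanging the sums, each k contributes w k times the mass of N consecutive cells
     starting at the k-th; these always cover ]x + K h, x + N h]. *)
  apply: (@le_trans _ _ (\sum_(j < N) \sum_(k < K) w k * q (j + k)%N)); last first.
    rewrite mulr_natl -[X in _ *+ X]card_ord -sumr_const.
    by apply: ler_sum => j _.
  rewrite exchange_big/= /W mulr_suml; apply: ler_sum => k _.
  rewrite -mulr_sumr ler_wpM2l//.
  have -> : \sum_(j < N) q (j + k)%N = mass pi (x + k%:R * h) ((x + k%:R * h) + N%:R * h).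
    rewrite -(sum_mass _ _ _ (ltW h0)) big_mkord; apply: eq_bigr => j _.
    by congr mass; rewrite -?natr1 natrD; ring.
  apply: mass_sub.
    by rewrite lerD2l ler_pM2r// ler_nat ltnW.
  by rewrite -addrA lerD2l lerDr mulr_ge0// ltW.
near=> x.
have xx0 : x0 <= x by near: x; apply: nbhs_pinfty_ge; exact: num_real.
have kx : W * mass pi (x + K%:R * h) (x + N%:R * h) <= N%:R * ((1 + dl) * (l / m) * Fb x).
  by near: x; exact: key.
have F0 := Fpos x.
have Kh : 0 <= K%:R * h by rewrite mulr_ge0// ltW.
have b1 := HC x (K%:R * h) xx0 Kh.
have b2 : mass pi (x + K%:R * h) (x + N%:R * h) <= (L + h) * (1 + eps / 2) / m * Fb x.
  have hW : 0 < h * W by rewrite mulr_gt0.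
  rewrite -(ler_pM2l hW); apply: (@le_trans _ _ (h * (N%:R * ((1 + dl) * (l / m) * Fb x)))).
    by rewrite -[leLHS]mulrA ler_wpM2l// ltW.
  have lF : 0 <= l / m * Fb x by rewrite mulr_ge0 ?tail_ge0// divr_ge0// ltW.
  apply: (@le_trans _ _ ((L + h) * ((1 + dl) * (l / m * Fb x)))).
    rewrite (_ : h * _ = N%:R * h * ((1 + dl) * (l / m * Fb x))); last by ring.
    by rewrite ler_wpM2r// mulr_ge0//; lra.
  rewrite (_ : h * W * _ = (L + h) * ((1 + eps / 2) * (h * W) * (Fb x / m))); last first.
    by ring.
  rewrite ler_wpM2l//; first by lra.
  rewrite (_ : (1 + dl) * (l / m * Fb x) = ((1 + dl) * l) * (Fb x / m)); last by ring.
  rewrite ler_wpM2r//; first by rewrite divr_ge0 ?tail_ge0// ltW.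
  apply: (@le_trans _ _ ((1 + eps / 2) * (l - dl * l))); last by rewrite ler_wpM2l//; lra.
  by rewrite (_ : l - dl * l = (1 - dl) * l); [rewrite mulrA ler_wpM2r//; [exact: ltW|nra]|ring].
have b0 : mass pi x (x + L) <= mass pi x (x + K%:R * h) + mass pi (x + K%:R * h) (x + N%:R * h).
  by apply: le_trans (mass_split_le _ _ _ _); rewrite mass_sub ?lerD2l.
apply: le_trans b0 _; apply: le_trans (lerD b1 b2) _.
rewrite -mulrDl ler_wpM2r ?tail_ge0//.
have : L0 * (eps / (2 * m)) <= L * (eps / (2 * m)).
  by rewrite ler_wpM2r// divr_ge0// ?mulr_ge0// ltW.
rewrite /L0 -mulrA (_ : 2 * m / eps * (eps / (2 * m)) = 1); last first.
  by field; rewrite !gt_eqF.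
rewrite mulr1 => H.
rewrite (_ : (L + h) * (1 + eps / 2) / m =
             L / m + L * (eps / (2 * m)) + h * (1 + eps / 2) / m); last first.
  by field; rewrite gt_eqF.
rewrite (_ : (1 + eps) * (L / m) = L / m + L * (eps / (2 * m)) + L * (eps / (2 * m))).
  by lra.
by field; rewrite gt_eqF.
Unshelve. all: by end_near. Qed.

End local_mass.

(** * The drift inequality obtained from stationarity *)

Section drift.
Context {R : realType} (pi nu : probability R R) (m : R).
Local Notation Fb := (tail nu).
Hypotheses
  (stationary : forall f : R -> \bar R, measurable_fun setT f -> (forall y, 0 <= f y)%E ->
    (\int[pi]_y f y = \int[nu]_s \int[pi]_y f (Num.max 0 (s + y))%R)%E)
  (inu : nu.-integrable setT EFin) (Enu : (\int[nu]_s s%:E = (- m)%:E)%E).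

Definition clamp (x L z : R) : R := Num.min (Num.max (z - x) 0) L.

(* Collects the boundary terms of clamp_increment once integrated over pi. *)
Definition excess (L s : R) : R := 2 * `|s| * (1 + Num.min `|s| L).

Lemma excess_ge0 L s : 0 <= L -> 0 <= excess L s.
Proof. by move=> L0; rewrite !mulr_ge0// addr_ge0// le_min normr_ge0. Qed.

Lemma measurable_clamp x L : measurable_fun setT (clamp x L).
Proof.
apply: measurable_minr => //; apply: measurable_maxr => //.
exact: measurable_funB.
Qed.

Lemma measurable_excess L : measurable_fun setT (excess L).
Proof.
apply: measurable_funM; first by apply: measurable_funM.
by apply: measurable_funD => //; exact: measurable_minr.
Qed.

Lemma clamp_ge0 x L z : 0 <= L -> 0 <= clamp x L z.
Proof. by move=> L0; rewrite /clamp le_min le_max lexx orbT. Qed.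

(* The test function z |-> clamp x L z has slope 1 on ]x, x + L] and is constant
   elsewhere, so its increment along a jump s is s for starting points y in
   ]x, x + L], up to boundary terms. *)
Lemma clamp_increment x L s y : 0 < L ->
  clamp x L y + Num.max s 0 * \1_(`]x, x + L]%classic) y
    + L * \1_(`]x + L - s, x]%classic) y <=
  clamp x L (s + y) + Num.max (- s) 0 * \1_(`]x, x + L]%classic) y
    + `|s| * \1_(`]x + L - Num.min `|s| L, x + L]%classic) y
    + Num.min `|s| L * \1_(`]x + L, x + L + `|s|]%classic) y.
Proof.
move=> L0; rewrite !indicE !mem_setE /= !in_itv/=.
have s1 := ler_norm s; have s2 := ler_norm (- s); rewrite normrN in s2.
have pn : Num.max s 0 - Num.max (- s) 0 = s.
  by rewrite /Num.max; case: (ltP s 0) => ?; case: (ltP (- s) 0) => ?; lra.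
have min0 : 0 <= Num.min `|s| L by rewrite le_min normr_ge0 ltW.
have cl0 z : 0 <= clamp x L z by apply: clamp_ge0; exact: ltW.
have clL z : L <= z - x -> clamp x L z = L.
  by move=> zL; rewrite /clamp; apply/min_idPr; rewrite le_max zL.
have clz z : z - x <= L -> z - x <= clamp x L z.
  by move=> zL; rewrite /clamp le_min zL andbT le_max lexx.
have bool0 (b : bool) (u : R) : 0 <= u -> 0 <= u * b%:R by move=> u0; rewrite mulr_ge0.
set b3 := (x + L - _ < y <= x + L); set b4 := (x + L < y <= _).
have t3 : 0 <= `|s| * b3%:R by exact: bool0.
have t4 : 0 <= Num.min `|s| L * b4%:R by exact: bool0.
case: (leP y x) => yx.
  have -> : clamp x L y = 0.
    by rewrite /clamp max_r ?subr_le0//; apply/min_idPl; exact: ltW.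
  rewrite /= !mulr0 andbT; case: ltP => ys; last by rewrite mulr0; have := cl0 (s + y); lra.
  rewrite clL; first by move: t3 t4; rewrite mulr1; lra.
  by lra.
rewrite andbF mulr0 /=; case: (leP y (x + L)) => yL; last first.
  rewrite !mulr0 clL; last by lra.
  have [sL|sL] := leP L (s + y - x); first by rewrite clL//; lra.
  have -> : b4 by rewrite /b4 yL/=; lra.
  have := clz (s + y) (ltW sL); have := cl0 (s + y); move: t3.
  by rewrite mulr1 addr0; case: (leP `|s| L) => ?; lra.
have -> : clamp x L y = y - x.
  by rewrite /clamp (max_l (_ : 0 <= y - x)) ?subr_ge0 ?(ltW yx)//; apply/min_idPl; lra.
rewrite !mulr1; have [sL|sL] := leP (s + y - x) L.
  by have := clz (s + y) sL; lra.
have -> : b3.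
  rewrite /b3 yL andbT ltrBlDr -ltrBlDl lt_min; apply/andP; split; lra.
by rewrite mulr1 clL; lra.
Qed.

Lemma integral_add_mass (f : R -> R) (k a b : R) : measurable_fun setT f ->
  (forall y, 0 <= f y) -> 0 <= k ->
  (\int[pi]_y (f y + k * \1_(`]a, b]%classic) y)%:E =
   \int[pi]_y (f y)%:E + (k * mass pi a b)%:E)%E.
Proof.
move=> mf f0 k0.
under eq_integral do rewrite EFinD EFinM.
rewrite ge0_integralD//; last 4 first.
- by move=> y _; rewrite lee_fin.
- exact/measurable_EFinP.
- by move=> y _; rewrite -EFinM lee_fin mulr_ge0.
- by apply: measurable_funeM; apply/measurable_EFinP; exact: measurable_indic.
rewrite ge0_integralZl//; last first.
  by apply/measurable_EFinP; exact: measurable_indic.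
by rewrite integral_indic// setIT EFinM massE.
Qed.

Context (C x0 : R).
Hypotheses (C0 : 0 < C)
  (HC : forall x u, x0 <= x -> 0 <= u -> mass pi x (x + u) <= C * (u + 1) * Fb x).

(** With k = min(|s|, L), the boundary terms are at most C Fb x times |s| (k + 1) + k (|s| + 1) <= 2
    |s| (1 + k), which is [excess]. Capping at L keeps the window ending at x + L inside [x, x + L],
    where [HC] applies and Fb is at most Fb x. *)
Let increment_bound (x L s : R) : x0 <= x -> 0 < L ->
  (\int[pi]_y (clamp x L y)%:E + (Num.max s 0 * mass pi x (x + L))%:E
     + (L * mass pi (x + L - s) x)%:E <=
   \int[pi]_y (clamp x L (s + y))%:E + (Num.max (- s) 0 * mass pi x (x + L))%:E
     + (C * Fb x * excess L s)%:E)%E.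
Proof.
move=> x0x L0.
have mc := measurable_clamp x L.
have mcs : measurable_fun setT (fun y => clamp x L (s + y)).
  by apply: measurableT_comp mc _; exact: measurable_funD.
have mi (k a b : R) : measurable_fun setT (fun y : R => k * \1_(`]a, b]%classic) y).
  by apply: measurable_funM => //; exact: measurable_indic.
have i0 (k a b y : R) : 0 <= k -> 0 <= k * \1_(`]a, b]%classic) y.
  by move=> k0; rewrite mulr_ge0.
have c0 y : 0 <= clamp x L y by apply: clamp_ge0; exact: ltW.
have p0 : 0 <= Num.max s 0 by rewrite le_max lexx orbT.
have n0 : 0 <= Num.max (- s) 0 by rewrite le_max lexx orbT.
have min0 : 0 <= Num.min `|s| L by rewrite le_min normr_ge0 ltW.
have L0' := ltW L0.
have m1 (f : R -> R) (k a b : R) : measurable_fun setT f ->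
  measurable_fun setT (fun y : R => f y + k * \1_(`]a, b]%classic) y).
  by move=> mf; exact: measurable_funD.
have n1 (f : R -> R) (k a b : R) : (forall y, 0 <= f y) -> 0 <= k ->
  forall y, 0 <= f y + k * \1_(`]a, b]%classic) y.
  by move=> f0 k0 y; rewrite addr_ge0 ?i0.
rewrite -!integral_add_mass//; [|exact: m1|exact: n1].
apply: (@le_trans _ _ (\int[pi]_y (clamp x L (s + y)
    + Num.max (- s) 0 * \1_(`]x, x + L]%classic) y
    + `|s| * \1_(`]x + L - Num.min `|s| L, x + L]%classic) y
    + Num.min `|s| L * \1_(`]x + L, x + L + `|s|]%classic) y)%:E)%E).
  apply: ge0_le_lower_integral => y _.
    by rewrite lee_fin !addr_ge0 ?i0.
  by rewrite lee_fin clamp_increment.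
rewrite !integral_add_mass//; [|exact: m1|exact: n1| |]; last 2 first.
- by do 2! apply: measurable_funD => //.
- by move=> y; rewrite !addr_ge0 ?i0.
rewrite -addeA leeD2l// -EFinD lee_fin.
have F0 := tail_ge0 nu.
have h1 : mass pi (x + L - Num.min `|s| L) (x + L) <= C * (Num.min `|s| L + 1) * Fb x.
  have minL : Num.min `|s| L <= L by rewrite ge_min lexx orbT.
  have := HC (x := x + L - Num.min `|s| L) _ min0; rewrite subrK.
  move/(_ (le_trans x0x _)) => H; apply: le_trans (H _) _; first by lra.
  rewrite ler_wpM2l ?tail_anti//; last by lra.
  by rewrite mulr_ge0 ?ltW//; lra.
have h2 : mass pi (x + L) (x + L + `|s|) <= C * (`|s| + 1) * Fb x.
  apply: le_trans (HC (x := x + L) _ (normr_ge0 s)) _; first by lra.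
  rewrite ler_wpM2l ?tail_anti//; last by lra.
  by rewrite mulr_ge0 ?addr_ge0 ?(ltW C0).
have mins : Num.min `|s| L <= `|s| by rewrite ge_min lexx.
apply: (@le_trans _ _ (`|s| * (C * (Num.min `|s| L + 1) * Fb x)
                      + Num.min `|s| L * (C * (`|s| + 1) * Fb x))).
  by apply: lerD; apply: ler_wpM2l.
rewrite /excess -subr_ge0.
rewrite (_ : _ - _ = C * Fb x * (`|s| - Num.min `|s| L)); last by ring.
by rewrite !mulr_ge0 ?subr_ge0 ?(ltW C0).
Qed.

Let q_pos := integrable_pos_fin_num measurableT inu.
Let q_neg := integrable_neg_fin_num measurableT inu.

Let max_funepos s : (Num.max s 0)%:E = EFin^\+%E s :> \bar R.
Proof. by rewrite funeposE -EFin_max. Qed.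

Let max_funeneg s : (Num.max (- s) 0)%:E = EFin^\-%E s :> \bar R.
Proof. by rewrite funenegE -EFin_max. Qed.

Lemma measurable_tail_shift (c : R) : measurable_fun setT (fun y : R => tail nu (c - y)).
Proof.
apply: measurableT_comp; first exact: measurable_tail.
exact: measurable_funB.
Qed.

(** Both sides are the product measure of the pairs with y <= x and s + y > x + L, the jumps across
    the whole window. *)
Let fubini_tail (x L : R) :
  (\int[nu]_s (mass pi (x + L - s) x)%:E =
   \int[pi]_(y in `]-oo, x]) (Fb (x + L - y))%:E)%E.
Proof.
pose D : set (R * R) := [set z | z.2 <= x] `&` [set z | x + L < z.1 + z.2].
have mD : measurable D.
  rewrite (_ : D = snd @^-1` `]-oo, x] `&` (fun z => z.1 + z.2) @^-1` `]x + L, +oo[).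
    apply: measurableI; rewrite -[X in measurable X]setTI.
      exact: measurable_snd.
    have : measurable_fun [set: R * R] (fun z : R * R => z.1 + z.2).
      by apply: measurable_funD; [exact: measurable_fst|exact: measurable_snd].
    exact.
  by apply/seteqP; split => z /=; rewrite !in_itv/= andbT.
have := @fubini_tonelli _ _ R R R nu pi (fun z => (\1_D z)%:E) _ _.
have -> : (\int[nu]_s \int[pi]_y (\1_D (s, y))%:E = \int[nu]_s (mass pi (x + L - s) x)%:E)%E.
  apply: eq_integral => s _; rewrite massE -[X in _ = pi X]setIT -integral_indic//.
  apply: eq_integral => y _; rewrite !indicE; congr (nat_of_bool _)%:R%:E.
  apply/idP/idP; rewrite !inE/= in_itv/= ltrBlDl.
    by case=> /= -> ->.
  by case/andP => ? ?; split.
move=> ->.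
- rewrite [RHS]integral_mkcond; apply: eq_integral => y _; rewrite /patch.
  case: ifPn => [|]; rewrite ?inE ?notin_setE/= in_itv/= => yx.
    rewrite tailE -[X in _ = nu X]setIT -integral_indic//.
    apply: eq_integral => s _; rewrite !indicE; congr (nat_of_bool _)%:R%:E.
    apply/idP/idP; rewrite !inE/= in_itv/= andbT ltrBlDr.
      by case.
    by split.
  by apply: integral0_eq => s _; rewrite indicE memNset//= => -[].
- exact/measurable_EFinP/measurable_indic.
- by move=> z; rewrite lee_fin.
Qed.

(** Integrate [increment_bound] over the step s. Stationarity makes the two integrals of [clamp]
    equal; being at most L they cancel, and q keeps the coefficient E s^- - E s^+ = m. *)
Lemma drift_inequality (x L : R) : x0 <= x -> 0 <= x -> 0 < L ->
  (L%:E * \int[pi]_(y in `]-oo, x]) (Fb (x + L - y))%:E <=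
   (m * mass pi x (x + L))%:E + (C * Fb x)%:E * \int[nu]_s (excess L s)%:E)%E.
Proof.
move=> x0x x_ge0 L0; set A := (\int[pi]_y (clamp x L y)%:E)%E.
set q := mass pi x (x + L).
have cl0 z : 0 <= clamp x L z by apply: clamp_ge0; exact: ltW.
have mcl := measurable_clamp x L.
have A0 : (0 <= A)%E by apply: integral_ge0 => y _; rewrite lee_fin.
have Afin : A \is a fin_num.
  rewrite ge0_fin_numE//; apply: (@le_lt_trans _ _ (\int[pi]_y (L%:E))%E).
    apply: ge0_le_lower_integral => y _; first by rewrite lee_fin.
    by rewrite lee_fin /clamp ge_min lexx orbT.
  by rewrite integral_cst// [X in (_ * X)%E](@probability_setT _ _ _ pi) mule1 ltry.
have st : A = (\int[nu]_s \int[pi]_y (clamp x L (s + y))%:E)%E.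
  rewrite /A stationary//; last exact/measurable_EFinP.
  apply: eq_integral => s _; apply: eq_integral => y _; congr EFin.
  (* The reflection at 0 is invisible to the test function because x >= 0. *)
  rewrite /clamp; congr Num.min; case: (leP 0 (s + y)) => // sy.
  by rewrite !max_r//; lra.
have mPhi : measurable_fun setT (fun s : R => \int[pi]_y (clamp x L (s + y))%:E)%E.
  apply: (@measurable_fun_fubini_tonelli_F _ _ R R R pi
    (fun z => (clamp x L (z.1 + z.2))%:E)).
    apply/measurable_EFinP; apply: measurableT_comp => //.
    by apply: measurable_funD; [exact: measurable_fst|exact: measurable_snd].
  by move=> z; rewrite lee_fin.
have mmass : measurable_fun setT (fun s : R => mass pi (x + L - s) x).
  apply: nondecreasing_measurable => // s t st'; apply: mass_sub => //; lra.
have mex := measurable_excess L.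
have ex0 s : 0 <= excess L s by apply: excess_ge0; exact: ltW.
have mpos : measurable_fun setT (fun s : R => Num.max s 0) by exact: measurable_maxr.
have mneg : measurable_fun setT (fun s : R => Num.max (- s) 0).
  by apply: measurable_maxr => //; exact: oppr_measurable.
have pos0 (s : R) : 0 <= Num.max s 0 by rewrite le_max lexx orbT.
have q0 : 0 <= q := mass_ge0 _ _ _.
have : (A + (\int[nu]_s (Num.max s 0)%:E) * q%:E + L%:E * \int[nu]_s (mass pi (x + L - s) x)%:E
   <= A + (\int[nu]_s (Num.max (- s) 0)%:E) * q%:E + (C * Fb x)%:E * \int[nu]_s (excess L s)%:E)%E.
  have -> : (A + (\int[nu]_s (Num.max s 0)%:E) * q%:E + L%:E * \int[nu]_s (mass pi (x + L - s) x)%:E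
     = \int[nu]_s (A + (Num.max s 0 * q)%:E + (L * mass pi (x + L - s) x)%:E))%E.
    rewrite ge0_integralD//; last 4 first.
    - by move=> s _; rewrite adde_ge0// lee_fin mulr_ge0.
    - by apply: emeasurable_funD => //; apply/measurable_EFinP; exact: measurable_funM.
    - by move=> s _; rewrite lee_fin mulr_ge0 ?mass_ge0// ltW.
    - by apply/measurable_EFinP; exact: measurable_funM.
    rewrite ge0_integralD//; last 2 first.
    - by move=> s _; rewrite lee_fin mulr_ge0.
    - by apply/measurable_EFinP; exact: measurable_funM.
    rewrite integral_cst// [X in (_ * X + _ + _)%E](@probability_setT _ _ _ nu) mule1.
    congr (_ + _ + _)%E.
      under [RHS]eq_integral do rewrite EFinM.
      by rewrite ge0_integralZr//; [exact/measurable_EFinP|move=> s _; rewrite lee_fin].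
    under [RHS]eq_integral do rewrite EFinM.
    rewrite ge0_integralZl//; first exact/measurable_EFinP.
    - by move=> s _; rewrite lee_fin mass_ge0.
    - by rewrite lee_fin ltW.
  have -> : (A + (\int[nu]_s (Num.max (- s) 0)%:E) * q%:E + (C * Fb x)%:E * \int[nu]_s (excess L s)%:E
     = \int[nu]_s (\int[pi]_y (clamp x L (s + y))%:E + (Num.max (- s) 0 * q)%:E
         + (C * Fb x * excess L s)%:E))%E.
    have CF : 0 <= C * Fb x by rewrite mulr_ge0 ?tail_ge0// ltW.
    have Phi0 s : (0 <= \int[pi]_y (clamp x L (s + y))%:E)%E.
      by apply: integral_ge0 => y _; rewrite lee_fin.
    rewrite ge0_integralD//; last 4 first.
    - by move=> s _; rewrite adde_ge0// lee_fin mulr_ge0.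
    - by apply: emeasurable_funD => //; apply/measurable_EFinP; exact: measurable_funM.
    - by move=> s _; rewrite lee_fin mulr_ge0.
    - by apply/measurable_EFinP; exact: measurable_funM.
    rewrite ge0_integralD//; last 2 first.
    - by move=> s _; rewrite lee_fin mulr_ge0.
    - by apply/measurable_EFinP; exact: measurable_funM.
    rewrite -st; congr (_ + _ + _)%E.
      under [RHS]eq_integral do rewrite EFinM.
      by rewrite ge0_integralZr//; [exact/measurable_EFinP|move=> s _; rewrite lee_fin].
    under [RHS]eq_integral do rewrite EFinM.
    by rewrite ge0_integralZl//; [exact/measurable_EFinP|move=> s _; rewrite lee_fin].
  apply: ge0_le_lower_integral => s _; last exact: increment_bound.
  rewrite adde_ge0//; first by rewrite adde_ge0// lee_fin mulr_ge0.
  by rewrite lee_fin mulr_ge0 ?mass_ge0// ltW.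
rewrite fubini_tail.
have -> : (\int[nu]_s (Num.max s 0)%:E = \int[nu]_s EFin^\+%E s)%E.
  by apply: eq_integral => s _; rewrite -max_funepos.
have -> : (\int[nu]_s (Num.max (- s) 0)%:E = \int[nu]_s EFin^\-%E s)%E.
  by apply: eq_integral => s _; rewrite -max_funeneg.
have := Enu; rewrite integralE -(fineK q_pos) -(fineK q_neg) -EFinB => -[].
set J := (\int[pi]_(y in _) _)%E; set r := (\int[nu]_s (excess L s)%:E)%E.
move: (fine _) (fine _) => j i ijm; clearbody A J r.
rewrite -!EFinM -!addeA leeD2lE// => H.
(* Here i and j are the means of the positive and negative parts, m = j - i. The terms [J] and [r]
   may be infinite, so only real terms are cancelled. *)
rewrite -(@leeD2lE _ (i * q)%:E)//.
apply: le_trans H _; rewrite addeA -EFinD leeD2r// lee_fin.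
by rewrite -mulrDl (_ : m = j - i) ?subrKC//; lra.
Qed.

End drift.

(** * The mean of [excess L] is o(L) *)

Section excess_small.
Context {R : realType} (nu : probability R R).
Hypothesis inu : nu.-integrable setT EFin.

(** Monotonicity in the window length lets a limit along the integers control every large L. *)
Let excess_anti (M L s : R) : 0 < M -> M <= L -> excess L s / L <= excess M s / M.
Proof.
move=> M0 ML; have L0 : 0 < L by exact: lt_le_trans ML.
rewrite ler_pdivrMr// mulrAC ler_pdivlMr// /excess -!mulrA ler_pM2l//.
rewrite ler_wpM2l//; have [sM|Ms] := leP `|s| M.
  by rewrite min_l ?(le_trans sM)// ler_wpM2l// addr_ge0.
have : Num.min `|s| L <= L by rewrite ge_min lexx orbT.
by nra.
Qed.

(** Dominated convergence: for integers n >= 1, excess n s / n tends to 0 for each s and is at most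
    4 |s|, because 1 + min(|s|, n) <= 2 n. *)
Lemma excess_small (e : R) : 0 < e -> exists L0, 0 < L0 /\
  forall L, L0 <= L -> (\int[nu]_s (excess L s)%:E <= (e * L)%:E)%E.
Proof.
move=> e0.
pose f (n : nat) (s : R) := (excess n.+1%:R s / n.+1%:R)%:E.
have mf n : measurable_fun setT (f n).
  by apply/measurable_EFinP/measurable_funM => //; exact: measurable_excess.
have f0 n (s : R) : 0 <= excess n.+1%:R s / n.+1%:R by rewrite divr_ge0 ?excess_ge0.
have idom : nu.-integrable setT (fun s => (4 * `|s|)%:E).
  have := integrableZl measurableT 4 (integrable_abse inu).
  by apply: eq_integrable => // s _ /=; rewrite EFinM.
have [||_ _ H] := @dominated_convergence _ _ _ nu setT measurableT f (cst 0%E)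
  (fun s => (4 * `|s|)%:E) mf (measurable_cst _) _ idom.
- apply: aeW => s _; apply: (cvg_trans _ (_ : EFin (0 : R) --> 0%E)) => //.
  apply: cvg_EFin; first exact: nearW.
  apply: (@squeeze_cvgr _ _ _ _ (cst 0) (fun n => (2 * `|s| * (1 + `|s|)) * harmonic n)).
  + apply: nearW => n; rewrite f0/= /harmonic ler_wpM2r//.
    by rewrite /excess ler_wpM2l ?mulr_ge0// lerD2l ge_min lexx.
  + exact: cvg_cst.
  + by rewrite -[X in _ --> X](mulr0 (2 * `|s| * (1 + `|s|))); apply: cvgMr; exact: cvg_harmonic.
- apply: aeW => s n _; rewrite /f/= lee_fin (ger0_norm (f0 n s)) ler_pdivrMr//.
  rewrite /excess.
  have : Num.min `|s| n.+1%:R <= n.+1%:R by rewrite ge_min lexx orbT.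
  have : 1 <= n.+1%:R :> R by rewrite ler1n.
  have := normr_ge0 s; set N := n.+1%:R; set k := Num.min _ _ => s0 N1 kN.
  have : `|s| * (1 + k) <= `|s| * (2 * N) by rewrite ler_wpM2l//; lra.
  by lra.
have : \forall n \near \oo, (\int[nu]_s f n s < e%:E)%E.
  by apply: (H _ (open_ereal_lt' _)); rewrite integral0 lte_fin.
move=> /filter_ex[n hn].
exists n.+1%:R; split => // L nL.
have L0 : 0 < L by exact: lt_le_trans nL.
apply: (@le_trans _ _ (\int[nu]_s (L%:E * f n s))%E).
  apply: ge0_le_lower_integral => s _; first by rewrite lee_fin excess_ge0// ltW.
  by rewrite -EFinM lee_fin mulrC -ler_pdivrMr// excess_anti.
rewrite ge0_integralZl//; last 2 first.
- by move=> s _; rewrite lee_fin.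
- by rewrite lee_fin ltW.
by rewrite mulrC EFinM; apply: lee_wpmul2l; [rewrite lee_fin ltW|exact: ltW].
Qed.

End excess_small.

(** * Smallness of the middle part of the convolution *)

Section convolution_middle.
Context {R : realType} (pi nu : probability R R) (m C x0 : R).
Local Notation Fb := (tail nu).
Hypotheses (Fpos : forall x, 0 < Fb x)
  (LT : forall c, 0 < c -> Fb (x - c) / Fb x @[x --> +oo] --> (1 : R))
  (m0 : 0 < m) (C0 : 0 < C) (inu : nu.-integrable setT EFin)
  (pi_ge0 : pi `]-oo, 0%R[%classic = 0%E)
  (drift : forall x L, x0 <= x -> 0 <= x -> 0 < L ->
    (L%:E * \int[pi]_(y in `]-oo, x]) (Fb (x + L - y))%:E <=
     (m * mass pi x (x + L))%:E + (C * Fb x)%:E * \int[nu]_s (excess L s)%:E)%E)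
  (upper : forall eps, 0 < eps -> exists L0, 0 < L0 /\
    forall L, L0 <= L ->
    \forall x \near +oo, mass pi x (x + L) <= (1 + eps) * (L / m) * Fb x).

Let pi_tight (e : R) : 0 < e -> exists A, 0 <= A /\ ((1 - e)%:E <= pi `[0%R, A]%classic)%E.
Proof.
move=> e0.
have mid : measurable_fun [set: R] (fun x : R => x) by exact: measurable_id.
(* The measure [pi] is the law of the identity, so tightness follows from its distribution function
   tending to 1. *)
pose X : {mfun R >-> R} := HB.pack (fun x : R => x)
  (isMeasurableFun.Build _ _ _ _ _ mid).
have H := cvg_cdfy1 (X : {RV pi >-> R}).
have e1 : ((1 - e)%:E < 1)%E by rewrite lte_fin; lra.
have := H _ (open_ereal_gt' e1) => -[M [_ HM]].
exists (Num.max 0 (M + 1)); split; first by rewrite le_max lexx.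
set B := Num.max 0 (M + 1).
have MM : M < B by rewrite lt_max; apply/orP; right; lra.
apply: le_trans (ltW (HM _ MM)) _.
rewrite /cdf /distribution /pushforward.
have : (pi (`]-oo, 0%R[%classic `|` `[0%R, B]%classic) <= 0 + pi `[0%R, B]%classic)%E.
  by rewrite -pi_ge0; exact: measureU2.
rewrite add0e; apply: le_trans; rewrite -[X @^-1` _]/(`]-oo, B]%classic).
apply: le_measure; rewrite ?inE; [exact: measurable_itv|exact: measurableU|].
move=> y /=; rewrite !in_itv/= => yA; have [y0|y0] := ltP y 0; [by left|right].
exact/andP.
Qed.

(** On [0, A] the integrand is at least Fb (x + L), which is equivalent to Fb x, and this interval
    carries mass at least 1 - e / 2. *)
Let head_bound (e : R) : 0 < e -> exists A, 0 <= A /\ forall L, 0 <= L ->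
  \forall x \near +oo,
   (((1 - e) * Fb x)%:E + \int[pi]_(y in `]A, x]) (Fb (x + L - y))%:E <=
    \int[pi]_(y in `]-oo, x]) (Fb (x + L - y))%:E)%E.
Proof.
move=> e0; have [A [A0 piA]] := pi_tight (divr_gt0 e0 (ltr0Sn R 1)).
exists A; split => // L L0.
near=> x.
have xA : A <= x by near: x; apply: nbhs_pinfty_ge; exact: num_real.
have FL : Fb x <= (1 + e / 2) * Fb (x + L).
  by near: x; apply: long_tailD => //; rewrite divr_gt0.
have mF := measurable_tail_shift nu (x + L).
have mFE (D : set R) : measurable D -> measurable_fun D (fun y => (Fb (x + L - y))%:E).
  by move=> mD; apply/measurable_EFinP; exact: measurable_funTS.
have F0 y : (0 <= (Fb (x + L - y))%:E)%E by rewrite lee_fin tail_ge0.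
apply: (@le_trans _ _ (\int[pi]_(y in `[0%R, A] `|` `]A, x]) (Fb (x + L - y))%:E)%E).
  rewrite ge0_integral_setU//; last 2 first.
  - by apply: mFE; exact: measurableU.
  - apply/disj_setPS => y /= []; rewrite !in_itv/= => /andP[_ yA] /andP[Ay _].
    by move: (lt_le_trans Ay yA); rewrite ltxx.
  rewrite leeD2r//; apply: (@le_trans _ _ (\int[pi]_(y in `[0%R, A]) (Fb (x + L))%:E)%E).
    rewrite integral_cst//; apply: (@le_trans _ _ ((Fb (x + L))%:E * (1 - e / 2)%:E)%E).
      rewrite -EFinM lee_fin.
      have F0' := Fpos (x + L); have F1 : Fb (x + L) <= Fb x by apply: tail_anti; lra.
      have [e2|e2] := leP 1 e.
        apply: (@le_trans _ _ ((1 - e) * Fb (x + L))).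
          by rewrite ler_wnM2l// subr_le0.
        by rewrite mulrC ler_wpM2l ?tail_ge0//; lra.
      apply: (@le_trans _ _ ((1 - e) * ((1 + e / 2) * Fb (x + L)))).
        by rewrite ler_wpM2l//; lra.
      rewrite mulrA mulrC ler_wpM2l ?tail_ge0//.
      by have := sqr_ge0 e; rewrite expr2; lra.
    by apply: lee_wpmul2l => //; rewrite lee_fin tail_ge0.
  apply: ge0_le_lower_integral => y /=; first by rewrite lee_fin tail_ge0.
  by rewrite in_itv/= => /andP[y0 _]; rewrite lee_fin tail_anti//; lra.
apply: ge0_subset_integral => //.
- exact: measurableU.
- exact: mFE.
- move=> y /= []; rewrite !in_itv/= => /andP[_ //].
  by move=> yA; exact: le_trans xA.
Unshelve. all: by end_near. Qed.


Let near_large (c : R) : \forall x \near +oo, c <= x.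
Proof. by apply: nbhs_pinfty_ge; exact: num_real. Qed.

Let middle_ge0 (D : set R) (x L : R) :
  (0 <= \int[pi]_(y in D) (Fb (x + L - y))%:E)%E.
Proof. by apply: integral_ge0 => y _; rewrite lee_fin tail_ge0. Qed.

(** After division by L, the right side of [drift] is at most (1 + 2 e / 3) Fb x, while the head
    already uses (1 - e / 3) Fb x; the difference is e Fb x. *)
Lemma middle_small (e : R) : 0 < e -> exists A L, [/\ 0 <= A, 0 < L &
  \forall x \near +oo,
    (\int[pi]_(y in `]A, x]) (Fb (x + L - y))%:E <= (e * Fb x)%:E)%E].
Proof.
move=> e0; pose e3 := e / 3; have e30 : 0 < e3 by rewrite divr_gt0.
have [A [A0 HA]] := head_bound e30.
have [L1 [L10 HL1]] := upper e30.
have [L2 [L20 HL2]] := excess_small inu (divr_gt0 e30 C0).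
pose L := Num.max L1 L2.
have LL1 : L1 <= L by rewrite le_max lexx.
have LL2 : L2 <= L by rewrite le_max lexx orbT.
have L0 : 0 < L by exact: lt_le_trans LL1.
exists A, L; split => //.
near=> x.
have x_x0 : x0 <= x by near: x; exact: near_large.
have x_0 : 0 <= x by near: x; exact: near_large.
have hb : (((1 - e3) * Fb x)%:E + \int[pi]_(y in `]A, x]) (Fb (x + L - y))%:E <=
    \int[pi]_(y in `]-oo, x]) (Fb (x + L - y))%:E)%E.
  by near: x; exact: HA (ltW L0).
have up : mass pi x (x + L) <= (1 + e3) * (L / m) * Fb x.
  by near: x; exact: HL1 LL1.
have dr := drift x_x0 x_0 L0.
have ex := HL2 _ LL2.
have F0 := tail_ge0 nu x.
have : (L%:E * (((1 - e3) * Fb x)%:E + \int[pi]_(y in `]A, x]) (Fb (x + L - y))%:E) <=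
        L%:E * ((1 + 2 * e3) * Fb x)%:E)%E.
  apply: (@le_trans _ _ (L%:E * \int[pi]_(y in `]-oo, x]) (Fb (x + L - y))%:E)%E).
    by apply: lee_wpmul2l => //; rewrite lee_fin ltW.
  apply: le_trans dr _.
  apply: (@le_trans _ _ ((m * ((1 + e3) * (L / m) * Fb x))%:E +
                         (C * Fb x)%:E * (e3 / C * L)%:E)%E).
    apply: leeD; first by rewrite lee_fin ler_wpM2l// ltW.
    by apply: lee_wpmul2l => //; rewrite lee_fin mulr_ge0// ltW.
  rewrite -!EFinM -EFinD lee_fin le_eqVlt; apply/orP; left; apply/eqP.
  by field; rewrite !gt_eqF.
rewrite lee_pmul2l// ?lte_fin// => H.
rewrite -(@leeD2lE _ ((1 - e3) * Fb x)%:E)//; apply: le_trans H _.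
rewrite -EFinD lee_fin le_eqVlt; apply/orP; left; apply/eqP.
by rewrite /e3; field.
Unshelve. all: by end_near. Qed.

(** The head alone makes the left side of [drift] at least (L / 2) Fb x. The excess term takes at
    most (L / 4) Fb x, so m times the mass of the window is at least (L / 4) Fb x. *)
Lemma mass_lower_bound : exists K dl, [/\ 0 < K, 0 < dl &
  \forall x \near +oo, dl * Fb x <= mass pi x (x + K)].
Proof.
have h0 : 0 < 1 / 2 :> R by [].
have [A [A0 HA]] := head_bound h0.
have q0 : 0 < 1 / 4 / C :> R by rewrite divr_gt0.
have [L [L0 HL]] := excess_small inu q0.
exists L, (L / (4 * m)); split => //; first by rewrite divr_gt0// mulr_gt0.
near=> x.
have x_x0 : x0 <= x by near: x; exact: near_large.
have x_0 : 0 <= x by near: x; exact: near_large.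
have hb : (((1 - 1 / 2) * Fb x)%:E + \int[pi]_(y in `]A, x]) (Fb (x + L - y))%:E <=
    \int[pi]_(y in `]-oo, x]) (Fb (x + L - y))%:E)%E.
  by near: x; exact: HA (ltW L0).
have F0 := tail_ge0 nu x.
have : (L%:E * ((1 - 1 / 2) * Fb x)%:E <=
        (m * mass pi x (x + L))%:E + (C * Fb x)%:E * (1 / 4 / C * L)%:E)%E.
  apply: (@le_trans _ _ (L%:E * \int[pi]_(y in `]-oo, x]) (Fb (x + L - y))%:E)%E).
    apply: lee_wpmul2l; first by rewrite lee_fin ltW.
    by apply: le_trans hb; rewrite leeDl.
  apply: le_trans (drift x_x0 x_0 L0) _; rewrite leeD2l//.
  apply: lee_wpmul2l; first by rewrite lee_fin mulr_ge0// ltW.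
  exact: HL.
rewrite -!EFinM -EFinD lee_fin (_ : C * Fb x * _ = 1 / 4 * L * Fb x) => [H|].
  by rewrite mulrAC ler_pdivrMr ?mulr_gt0//; lra.
by field; rewrite gt_eqF.
Unshelve. all: by end_near. Qed.

Lemma convolution_middle_small (e : R) : 0 < e -> exists A, 0 < A /\
  \forall x \near +oo,
    (\int[lebesgue_measure]_(z in `[A, (x - A)%R]) (Fb z * Fb (x - z))%:E <=
     (e * Fb x)%:E)%E.
Proof.
move=> e0.
have [K [dl [K0 dl0 [z0 [_ Hz]]]]] := mass_lower_bound.
(* The bound will be multiplied by 1 / dl from [mass_lower_bound], by 2 from removing the shift by
   L, and by K from Fubini. *)
have e'0 : 0 < e * dl / (2 * K) by rewrite divr_gt0 ?mulr_gt0.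
have [A0 [L [A00 L0 Hmid]]] := middle_small e'0.
have [B0 [_ HB]] := long_tailD Fpos LT (ltW L0) (ltr01 : (0 : R) < 1).
(* For z in [A, x - A] and y in ]z, z + K], these thresholds give z > z0, A0 < y <= x and x - y >
   B0. *)
pose A := Num.max (Num.max A0 (z0 + 1)) (Num.max (B0 + 1 + K) (K + 1)).
have AA0 : A0 <= A by rewrite /A !le_max lexx.
have Az0 : z0 < A by rewrite /A !lt_max ltrDl ltr01 orbT.
have AB0 : B0 + 1 + K <= A by rewrite /A !le_max lexx orbT.
have A1 : K + 1 <= A by rewrite /A !le_max lexx !orbT.
exists A; split; first by lra.
move: Hmid; apply: filterS => x Hmid.
(* By mass_lower_bound, Fb z is at most pi]z, z + K] / dl; Fubini then turns the
   integral over z into a factor K. *)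
pose D : set (R * R) := [set z | z.1 < z.2] `&` [set z | z.2 <= z.1 + K].
have mD : measurable D.
  rewrite (_ : D = (fun z => z.2 - z.1) @^-1` `]0%R, K]).
    have : measurable_fun [set: R * R] (fun z : R * R => z.2 - z.1).
      by apply: measurable_funB; [exact: measurable_snd|exact: measurable_fst].
    by move=> mf; rewrite -[X in measurable X]setTI; exact: mf.
  apply/seteqP; split => z /=; rewrite !in_itv/= subr_gt0 lerBlDl.
    by case=> -> ->.
  by case/andP.
pose Psi (y : R) : R := \1_(`]A0, x]%classic) y * Fb (x + L - y).
have Psi0 y : 0 <= Psi y by rewrite mulr_ge0 ?tail_ge0.
have mPsi : measurable_fun setT Psi.
  by apply: measurable_funM; [exact: measurable_indic|exact: measurable_tail_shift].
pose f (z : R * R) : \bar R := (Psi z.2 * \1_D z)%:E.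
have mf : measurable_fun [set: R * R] f.
  apply/measurable_EFinP/measurable_funM; last exact: measurable_indic.
  by apply: measurableT_comp => //; exact: measurable_snd.
have f0 z : (0 <= f z)%E by rewrite lee_fin mulr_ge0.
apply: (@le_trans _ _ (\int[lebesgue_measure]_(z in `[A, (x - A)%R])
    ((2 / dl)%:E * \int[pi]_y f (z, y)))%E).
  apply: ge0_le_lower_integral => z /=; first by rewrite lee_fin mulr_ge0 ?tail_ge0.
  rewrite in_itv/= => /andP[Az zxA].
  have zz0 := Hz z (lt_le_trans Az0 Az).
  have H1 : ((Fb z * Fb (x - z))%:E <=
      (dl^-1 * Fb (x - z))%:E * pi `]z, (z + K)%R]%classic)%E.
    rewrite -massE -EFinM lee_fin mulrAC ler_wpM2r ?tail_ge0//.
    by rewrite ler_pdivlMl.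
  apply: (le_trans H1); rewrite -[X in pi X]setIT -integral_indic// -ge0_integralZl//; last 2 first.
  - by apply/measurable_EFinP; exact: measurable_indic.
  - by rewrite lee_fin mulr_ge0 ?tail_ge0// invr_ge0 ltW.
  rewrite -ge0_integralZl//; last 2 first.
  - by apply: measurableT_comp mf _; exact: pair1_measurable.
  - by rewrite lee_fin divr_ge0// ltW.
  apply: ge0_le_lower_integral => y _.
    by rewrite -EFinM lee_fin !mulr_ge0 ?tail_ge0// invr_ge0 ltW.
  rewrite /f -!EFinM lee_fin /=.
  have [yz|yz] := boolP (y \in `]z, z + K]%classic); last first.
    by rewrite indicE (negbTE yz) mulr0 mulr_ge0 ?divr_ge0 ?mulr_ge0// ltW.
  rewrite indicE yz mulr1; move: yz; rewrite inE/= in_itv/= => /andP[zy yzK].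
  rewrite /Psi [\1_D _]indicE mem_set; last by split.
  rewrite indicE mem_set; last by rewrite /= in_itv/=; apply/andP; split; lra.
  rewrite mul1r mulr1 (_ : 2 / dl * _ = dl^-1 * (2 * Fb (x + L - y))); last by ring.
  rewrite ler_pM2l ?invr_gt0//.
  (* As y > z, passing from x - z to x - y increases Fb; shifting the argument by L then costs the
     factor 2. *)
  apply: (@le_trans _ _ (Fb (x - y))); first by rewrite tail_anti//; lra.
  have := HB (x - y); rewrite (_ : x - y + L = x + L - y); last by ring.
  by apply; lra.
rewrite ge0_integralZl//; last 3 first.
- apply: measurable_funTS.
  exact: (@measurable_fun_fubini_tonelli_F _ _ _ _ R pi f mf f0).
- by move=> z _; apply: integral_ge0.
- by rewrite lee_fin divr_ge0// ltW.
apply: (@le_trans _ _ ((2 / dl)%:E * \int[lebesgue_measure]_z \int[pi]_y f (z, y))%E).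
  apply: lee_wpmul2l; first by rewrite lee_fin divr_ge0// ltW.
  apply: ge0_subset_integral => //.
  - exact: (@measurable_fun_fubini_tonelli_F _ _ _ _ R pi f mf f0).
  - by move=> z _; apply: integral_ge0.
rewrite fubini_tonelli//.
have -> : (\int[pi]_y \int[lebesgue_measure]_z f (z, y) = \int[pi]_y ((Psi y)%:E * K%:E))%E.
  apply: eq_integral => y _; rewrite /f/=.
  under eq_integral do rewrite EFinM.
  rewrite ge0_integralZl//; last 2 first.
  - apply/measurable_EFinP/measurableT_comp; first exact: measurable_indic.
    exact: pair2_measurable.
  - by rewrite lee_fin.
  congr (_ * _)%E.
  rewrite (_ : (fun z => (\1_D (z, y))%:E) = (fun z => (\1_(`[y - K, y[%classic) z)%:E)).
    rewrite integral_indic// setIT -[LHS]/(lebesgue_measure `[y - K, y[%classic).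
    rewrite lebesgue_measure_itv/= lte_fin ltrBlDr ltrDl K0.
    by rewrite -EFinB; congr EFin; ring.
  apply/funext => z; rewrite !indicE; congr (nat_of_bool _)%:R%:E.
  apply/idP/idP; rewrite !inE/= in_itv/= lerBlDr.
    by case=> /= -> ->.
  by case/andP => ? ?; split.
rewrite ge0_integralZr//; last 3 first.
- exact/measurable_EFinP.
- by move=> y _; rewrite lee_fin.
- by rewrite lee_fin ltW.
have -> : (\int[pi]_y (Psi y)%:E = \int[pi]_(y in `]A0, x]) (Fb (x + L - y))%:E)%E.
  rewrite [RHS]integral_mkcond; apply: eq_integral => y _.
  rewrite /Psi /patch indicE; case: ifPn => _; first by rewrite mul1r.
  by rewrite mul0r.
apply: (@le_trans _ _ ((2 / dl)%:E * ((e * dl / (2 * K) * Fb x)%:E * K%:E))%E).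
  apply: lee_wpmul2l; first by rewrite lee_fin divr_ge0// ltW.
  by apply: lee_wpmul2r; first by rewrite lee_fin ltW.
rewrite -!EFinM lee_fin le_eqVlt; apply/orP; left; apply/eqP.
by field; rewrite !gt_eqF.
Qed.

End convolution_middle.

(** Lebesgue measure is invariant under z |-> x - z: the preimage of ]a, b] is [x - b, x - a[, of
    the same length. *)
Lemma ge0_integral_reflection {R : realType} (x A : R) (f : R -> \bar R) :
  measurable_fun setT f -> (forall y, 0 <= f y)%E ->
  (\int[lebesgue_measure]_(z in `[(x - A)%R, x]) f (x - z)%R =
   \int[lebesgue_measure]_(z in `[0%R, A]) f z)%E.
Proof.
move=> mf f0.
have mphi : measurable_fun [set: measurableTypeR R]
    (fun z : measurableTypeR R => x - z : measurableTypeR R).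
  exact: measurable_funB.
have -> : `[(x - A), x]%classic = (fun z => x - z) @^-1` `[0, A]%classic.
  by apply/seteqP; split => z /=; rewrite !in_itv/= => /andP[? ?]; apply/andP; split; lra.
rewrite -(@ge0_integral_pushforward _ _ _ _ _ _ mphi lebesgue_measure _ f)//; last first.
  exact: measurable_funTS.
apply: eq_measure_integral => B mB _.
pose mu := measure_function_pushforward__canonical__measure_function_Measure
  (@lebesgue_measure R) mphi.
apply/esym/(lebesgue_measure_unique (mu := mu)) => //= _ [[a b] _ <-]/=.
rewrite /pushforward/=.
have -> : (fun z => x - z) @^-1` `]a, b]%classic = `[x - b, x - a[%classic.
  by apply/seteqP; split => z /=; rewrite !in_itv/= => /andP[? ?]; apply/andP; split; lra.
rewrite !lebesgue_measure_itv/= !lte_fin ltrD2l ltrN2.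
by case: ifP => // _; rewrite -!EFinB; congr EFin; ring.
Qed.

(** * From the small middle part to membership in S^* *)

Section Sstar.
Context {R : realType} (nu : probability R R).
Local Notation Fb := (tail nu).
Local Notation leb := (@lebesgue_measure R).
Hypotheses (Fpos : forall x, 0 < Fb x)
  (LT : forall c, 0 < c -> Fb (x - c) / Fb x @[x --> +oo] --> (1 : R))
  (middle : forall e, 0 < e -> exists A, 0 < A /\
    \forall x \near +oo,
    (\int[leb]_(z in `[A, (x - A)%R]) (Fb z * Fb (x - z))%:E <= (e * Fb x)%:E)%E).

Let mFb : measurable_fun setT (fun z => (Fb z)%:E).
Proof. by apply/measurable_EFinP; exact: measurable_tail. Qed.

Let mprod x : measurable_fun setT (fun z => (Fb z * Fb (x - z))%:E).
Proof.
apply/measurable_EFinP/measurable_funM; first exact: measurable_tail.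
exact: measurable_tail_shift.
Qed.

Let prod0 x z : (0 <= (Fb z * Fb (x - z))%:E)%E.
Proof. by rewrite lee_fin mulr_ge0 ?tail_ge0. Qed.

Let Fb0 z : (0 <= (Fb z)%:E)%E. Proof. by rewrite lee_fin tail_ge0. Qed.

Let a (A : R) : \bar R := (\int[leb]_(z in `[0%R, A]) (Fb z)%:E)%E.
Let M : \bar R := (\int[leb]_(z in `[0%R, +oo[) (Fb z)%:E)%E.
Let conv x : \bar R := (\int[leb]_(z in `[0%R, x]) (Fb z * Fb (x - z))%:E)%E.

Let a_reflect x A : a A = (\int[leb]_(z in `[(x - A)%R, x]) (Fb (x - z))%:E)%E.
Proof. exact: esym (ge0_integral_reflection x A mFb Fb0). Qed.

(** Permits covers by closed intervals that share an endpoint. *)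
Let sub_additive (D1 D2 D : set R) (f : R -> \bar R) :
  measurable D1 -> measurable D2 -> measurable D -> D `<=` D1 `|` D2 ->
  measurable_fun setT f -> (forall z, 0 <= f z)%E ->
  (\int[leb]_(z in D) f z <= \int[leb]_(z in D1) f z + \int[leb]_(z in D2) f z)%E.
Proof.
move=> mD1 mD2 mD sD mf f0.
apply: (@le_trans _ _ (\int[leb]_(z in D1 `|` (D2 `\` D1)) f z)%E).
  apply: ge0_subset_integral => //.
  - by apply: measurableU => //; exact: measurableD.
  - exact: measurable_funTS.
  - by move=> z /sD [|z2]; [left|have [z1|z1] := pselect (D1 z); [left|right]].
rewrite ge0_integral_setU//; last 3 first.
- exact: measurableD.
- exact: measurable_funTS.
- by apply/disj_setPS => z [z1 [_]].
rewrite leeD2l//; apply: ge0_subset_integral => //.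
- exact: measurableD.
- exact: measurable_funTS.
Qed.

Let a_fin A : 0 <= A -> a A \is a fin_num.
Proof.
move=> A0; rewrite ge0_fin_numE; last by apply: integral_ge0.
apply: (@le_lt_trans _ _ (\int[leb]_(z in `[0%R, A]) 1)%E).
  by apply: ge0_le_lower_integral => z _ //; rewrite lee_fin tail_le1.
rewrite integral_cst// mul1e -[X in (X < _)%E]/(leb `[0%R, A]%classic).
by rewrite lebesgue_measure_itv/=; case: ifP => _; rewrite ?ltry// -EFinB ltry.
Qed.

Let a_le_M A : (a A <= M)%E.
Proof.
apply: ge0_subset_integral => //; first exact: measurable_funTS.
by move=> z /=; rewrite !in_itv/= => /andP[->].
Qed.

(** For z >= 0 one has Fb (x - z) >= Fb x, so dividing the middle bound by Fb x shows that Fb has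
    integral at most e over [A, n + 1], uniformly in n. Finiteness of [M] comes from this. *)
Let M_le (e A : R) : 0 < e -> 0 < A ->
  (\forall x \near +oo,
    (\int[leb]_(z in `[A, (x - A)%R]) (Fb z * Fb (x - z))%:E <= (e * Fb x)%:E)%E) ->
  (M <= a A + e%:E)%E.
Proof.
move=> e0 A0 [x1 [_ Hx1]].
rewrite /M ge0_integral_ereal_sup; last 2 first.
- by move=> z; exact: tail_ge0.
- exact: measurable_tail.
apply: ge_ereal_sup => _ [n _ <-].
apply: (@le_trans _ _ (a A + \int[leb]_(z in `[A, n.+1%:R]) (Fb z)%:E)%E).
  apply: sub_additive => // z /=; rewrite !in_itv/= => /andP[z0 zn].
  by case: (leP z A) => zA; [left|right]; apply/andP; split => //; exact: ltW.
rewrite leeD2l//.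
(* Large enough for the middle bound to apply and for [A, n + 1] to lie in [A, x - A]. *)
pose x := Num.max (x1 + 1) (n.+1%:R + A).
have xx1 : x1 < x by rewrite lt_max ltrDl ltr01.
have nx : n.+1%:R + A <= x by rewrite le_max lexx orbT.
rewrite -(@lee_pmul2l _ (Fb x)%:E)// ?lte_fin// -EFinM (mulrC (Fb x)).
apply: le_trans (Hx1 _ xx1).
rewrite -ge0_integralZl//; last exact: measurable_funTS.
apply: (@le_trans _ _ (\int[leb]_(z in `[A, n.+1%:R]) (Fb z * Fb (x - z))%:E)%E).
  apply: ge0_le_lower_integral => z /=.
    by rewrite -EFinM lee_fin mulr_ge0 ?tail_ge0.
  rewrite in_itv/= => /andP[Az _].
  by rewrite -EFinM lee_fin mulrC ler_wpM2l ?tail_ge0// tail_anti//; lra.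
apply: ge0_subset_integral => //; first exact: measurable_funTS (mprod x).
by move=> z /=; rewrite !in_itv/= => /andP[-> ?]/=; lra.
Qed.

Let M_fin : M \is a fin_num.
Proof.
have [A [A0 HA]] := middle (ltr01 : (0 : R) < 1).
rewrite ge0_fin_numE; last by apply: integral_ge0.
apply: le_lt_trans (M_le ltr01 A0 HA) _.
by rewrite -(fineK (a_fin (ltW A0))) -EFinD ltry.
Qed.

(** On [0, A] the factor Fb (x - z) is at most Fb (x - A) <= (1 + e) Fb x; the piece [x - A, x] is
    its mirror image. *)
Let conv_upper (e A : R) : 0 < e -> 0 < A ->
  (\forall x \near +oo,
    (\int[leb]_(z in `[A, (x - A)%R]) (Fb z * Fb (x - z))%:E <= (e * Fb x)%:E)%E) ->
  \forall x \near +oo, (conv x <= ((2 * (1 + e) * fine M + e) * Fb x)%:E)%E.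
Proof.
move=> e0 A0 Hmid; near=> x.
have FxA : Fb (x - A) <= (1 + e) * Fb x by near: x; apply: long_tailB => //; exact: ltW.
have mid : (\int[leb]_(z in `[A, (x - A)%R]) (Fb z * Fb (x - z))%:E <= (e * Fb x)%:E)%E.
  by near: x.
have aA : fine (a A) <= fine M by apply: fine_le => //; exact: a_fin (ltW A0).
have aA0 : 0 <= fine (a A) by apply: fine_ge0; exact: integral_ge0.
have first_part : (\int[leb]_(z in `[0%R, A]) (Fb z * Fb (x - z))%:E <=
    ((1 + e) * Fb x * fine (a A))%:E)%E.
  rewrite EFinM (fineK (a_fin (ltW A0))) /a -ge0_integralZl//; last 2 first.
  - exact: measurable_funTS.
  - by rewrite lee_fin mulr_ge0 ?tail_ge0//; lra.
  apply: ge0_le_lower_integral => z //=; rewrite in_itv/= => /andP[z0 zA].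
  rewrite -EFinM lee_fin mulrC ler_wpM2r ?tail_ge0//; apply: le_trans FxA.
  by rewrite tail_anti//; lra.
have last_part : (\int[leb]_(z in `[(x - A)%R, x]) (Fb z * Fb (x - z))%:E <=
    ((1 + e) * Fb x * fine (a A))%:E)%E.
  rewrite EFinM (fineK (a_fin (ltW A0))).
  rewrite (a_reflect x) -ge0_integralZl//; last 2 first.
  - by apply: measurable_funTS; apply/measurable_EFinP; exact: measurable_tail_shift.
  - by rewrite lee_fin mulr_ge0 ?tail_ge0//; lra.
  apply: ge0_le_lower_integral => z //=; rewrite in_itv/= => /andP[z0 zA].
  rewrite -EFinM lee_fin ler_wpM2r ?tail_ge0//; apply: le_trans FxA.
  by rewrite tail_anti.
apply: (@le_trans _ _ (\int[leb]_(z in `[0%R, A]) (Fb z * Fb (x - z))%:E +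
   (\int[leb]_(z in `[A, (x - A)%R]) (Fb z * Fb (x - z))%:E +
    \int[leb]_(z in `[(x - A)%R, x]) (Fb z * Fb (x - z))%:E))%E).
  apply: (@le_trans _ _ (\int[leb]_(z in `[0%R, A]) (Fb z * Fb (x - z))%:E +
     \int[leb]_(z in `[A, x]) (Fb z * Fb (x - z))%:E)%E).
    apply: sub_additive => // z /=; rewrite !in_itv/= => /andP[z0 zn].
    by case: (leP z A) => zA; [left|right]; apply/andP; split => //; exact: ltW.
  rewrite leeD2l//; apply: sub_additive => // z /=; rewrite !in_itv/= => /andP[z0 zn].
  by case: (leP z (x - A)) => zA; [left|right]; apply/andP; split => //; exact: ltW.
apply: le_trans (leeD first_part (leeD mid last_part)) _.
rewrite -!EFinD lee_fin.
have F0 := tail_ge0 nu x.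
have : (1 + e) * Fb x * fine (a A) <= (1 + e) * Fb x * fine M.
  by rewrite ler_wpM2l// mulr_ge0//; lra.
by lra.
Unshelve. all: by end_near. Qed.

(** The end pieces are disjoint for x >= 2 A + 1. Each is at least Fb x times the integral of Fb
    over [0, A], which [M_le] places within e of [M]. *)
Let conv_lower (e A : R) : 0 < e -> 0 < A ->
  (\forall x \near +oo,
    (\int[leb]_(z in `[A, (x - A)%R]) (Fb z * Fb (x - z))%:E <= (e * Fb x)%:E)%E) ->
  \forall x \near +oo, (((2 * fine M - 2 * e) * Fb x)%:E <= conv x)%E.
Proof.
move=> e0 A0 Hmid; near=> x.
have xA : 2 * A + 1 <= x by near: x; apply: nbhs_pinfty_ge; exact: num_real.
have aA : fine M <= fine (a A) + e.
  rewrite -lee_fin fineK// EFinD (fineK (a_fin (ltW A0))).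
  exact: M_le e0 A0 Hmid.
have first_part : ((Fb x * fine (a A))%:E <=
    \int[leb]_(z in `[0%R, A]) (Fb z * Fb (x - z))%:E)%E.
  rewrite EFinM (fineK (a_fin (ltW A0))) /a -ge0_integralZl//; last exact: measurable_funTS.
  apply: ge0_le_lower_integral => z /=.
    by rewrite -EFinM lee_fin mulr_ge0 ?tail_ge0.
  rewrite in_itv/= => /andP[z0 zA].
  by rewrite -EFinM lee_fin mulrC ler_wpM2l ?tail_ge0// tail_anti//; lra.
have last_part : ((Fb x * fine (a A))%:E <=
    \int[leb]_(z in `[(x - A)%R, x]) (Fb z * Fb (x - z))%:E)%E.
  rewrite EFinM (fineK (a_fin (ltW A0))).
  rewrite (a_reflect x) -ge0_integralZl//; last first.
    by apply: measurable_funTS; apply/measurable_EFinP; exact: measurable_tail_shift.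
  apply: ge0_le_lower_integral => z /=.
    by rewrite -EFinM lee_fin mulr_ge0 ?tail_ge0.
  rewrite in_itv/= => /andP[z0 zA].
  by rewrite -EFinM lee_fin ler_wpM2r ?tail_ge0// tail_anti.
apply: (@le_trans _ _ (\int[leb]_(z in `[0%R, A] `|` `[(x - A)%R, x]) (Fb z * Fb (x - z))%:E)%E).
  rewrite ge0_integral_setU//; last 2 first.
  - exact: measurable_funTS (mprod x).
  - apply/disj_setPS => z /= []; rewrite !in_itv/= => /andP[_ z1] /andP[z2 _].
    by exfalso; lra.
  apply: le_trans (leeD first_part last_part); rewrite -EFinD lee_fin.
  have F0 := tail_ge0 nu x.
  have : fine M * Fb x <= (fine (a A) + e) * Fb x by rewrite ler_wpM2r.
  by lra.
apply: ge0_subset_integral => //; first exact: measurableU.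
  exact: measurable_funTS (mprod x).
by move=> z /= []; rewrite !in_itv/= => /andP[? ?]; apply/andP; split; lra.
Unshelve. all: by end_near. Qed.

Lemma classSstar_of_middle (G : R -> R) : (forall x, 1 - G x = Fb x) -> classSstar G.
Proof.
move=> GE; split; first by move=> x; rewrite GE.
have -> : m_plus G = (fine M)%:E.
  by rewrite fineK//; apply: eq_integral => z _; rewrite GE.
have convE x : \int[leb]_(y in `[0, x]) ((1 - G (x - y)) * (1 - G y)) = fine (conv x).
  by rewrite /Rintegral; congr fine; apply: eq_integral => z _; rewrite !GE mulrC.
rewrite -EFinM; apply: cvg_EFin; first exact: nearW.
rewrite [X in X @ _ --> _](_ : _ = fun x => fine (conv x) / Fb x); last first.
  by apply/funext => x /=; rewrite convE GE.
apply/cvgrPdist_le => e e0.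
have M0 : 0 <= fine M by apply: fine_ge0; exact: integral_ge0.
(* The upper error 2 e1 M + e1 and the lower error 2 e1 are both at most e1 (2 M + 2) = e. *)
pose e1 := e / (2 * fine M + 2).
have e10 : 0 < e1 by rewrite divr_gt0//; lra.
have e1E : e = e1 * (2 * fine M + 2) by rewrite /e1 divfK// gt_eqF//; lra.
have [A [A0 HA]] := middle e10.
near=> x.
have up : (conv x <= ((2 * (1 + e1) * fine M + e1) * Fb x)%:E)%E.
  by near: x; exact: conv_upper A0 HA.
have low : (((2 * fine M - 2 * e1) * Fb x)%:E <= conv x)%E.
  by near: x; exact: conv_lower A0 HA.
(* The class is defined with a real-valued integral, that is, through [fine]; the extended bounds
   transfer to it once [conv x] is finite. *)
have cfin : conv x \is a fin_num.
  rewrite ge0_fin_numE; last by apply: integral_ge0.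
  exact: le_lt_trans up (ltry _).
move: up low; rewrite -(fineK cfin) !lee_fin -(ler_pdivrMr _ _ (Fpos x)) -(ler_pdivlMr _ _ (Fpos x)) => up low.
have eM : 0 <= e1 * fine M by rewrite mulr_ge0// ltW.
by rewrite ler_distlC; apply/andP; split; lra.
Unshelve. all: by end_near. Qed.

End Sstar.

Theorem theorem2 (d : measure_display) (T : measurableType d) (R : realType)
  (P : probability T R) (xi : nat -> {RV P >-> R}) (m : R) (g : R -> R) :
  mutually_independent xi ->
  identically_distributed xi ->
  (* finite mean E xi_1 = -m < 0 *)
  P.-integrable setT (EFin \o xi 0%N) ->
  ('E_P[xi 0%N] = (- m)%:E)%E -> 0 < m ->
  (* F is long-tailed, with F x = P(xi_1 <= x) *)
  let F := fun x : R => fine (cdf (xi 0%N) x) in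
  (forall x, 0 < 1 - F x) ->
  (forall c, 0 < c -> (1 - F (x - c)) / (1 - F x) @[x --> +oo] --> (1 : R)) ->
  (* pi is the distribution of M = sup_n S_n *)
  let pi := pushforward P (rwalk_sup xi) in
  classGstar g ->
  ((\int[pi]_(y in `]x, +oo[) (g (y - x))%:E)%E / (1 - F x)%:E)%E
     @[x --> +oo]
     --> ((m^-1)%:E * \int[lebesgue_measure]_(t in `[0%R, +oo[) (g t)%:E)%E ->
  classSstar F.
Proof.
move=> ind idd ixi Exi m0 F Fpos LT pi gG limG.
have mM := measurable_rwalk_sup xi.
pose M : {mfun T >-> R} :=
  HB.pack (rwalk_sup xi) (isMeasurableFun.Build _ _ _ _ _ mM).
pose nu : probability R R := distribution P (xi 0%N).
pose mu : probability R R := distribution P M.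
have FE x : 1 - F x = tail nu x.
  have := cdf_ccdf_1 (xi 0%N) x.
  rewrite -[ccdf _ _]/(nu `]x, +oo[%classic) -tailE.
  rewrite -(fineK (_ : cdf (xi 0%N) x \is a fin_num)) ?fin_num_measure//.
  by rewrite -EFinD => -[<-]; rewrite addrAC subrr add0r.
have tpos x : 0 < tail nu x by rewrite -FE.
have tLT c : 0 < c -> tail nu (x - c) / tail nu x @[x --> +oo] --> (1 : R).
  by move=> c0; have := LT c c0; under eq_fun do rewrite !FE.
have tlim : ((\int[mu]_(y in `]x, +oo[) (g (y - x))%:E)%E / (tail nu x)%:E)%E @[x --> +oo] -->
    ((m^-1)%:E * \int[lebesgue_measure]_(t in `[0%R, +oo[) (g t)%:E)%E.
  by move: limG; under eq_fun do rewrite FE.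
(* Besides the hypotheses on g and on the tail, the analytic sections receive from the walk only
   this stationarity, the mean of [nu], and the fact that [mu] is carried by the nonnegative
   reals. *)
have stationary (f : R -> \bar R) : measurable_fun setT f -> (forall y, 0 <= f y)%E ->
    (\int[mu]_y f y = \int[nu]_s \int[mu]_y f (Num.max 0 (s + y))%R)%E.
  move=> mf f0; rewrite ge0_integral_distribution// [LHS](lindley_equation ind idd ixi Exi m0)//.
  apply: eq_integral => s _; rewrite ge0_integral_distribution//.
  by apply: measurableT_comp mf _; apply: measurable_maxr => //; exact: measurable_funD.
have inu : nu.-integrable setT EFin.
  by apply: integrable_pushforward => //; exact: measurable_funPT.
have Enu : (\int[nu]_s s%:E = (- m)%:E)%E.
  by rewrite integral_distribution// -Exi unlock.
have mu_ge0 : mu `]-oo, 0%R[%classic = 0%E.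
  rewrite -[LHS]/(P (M @^-1` `]-oo, 0%R[%classic)) (_ : _ @^-1` _ = set0) ?measure0//.
  apply/seteqP; split => w //=; rewrite in_itv/= ltNge.
  by move=> /negP; apply; exact: rwalk_sup_ge0.
have [C [x0 [C0 HC]]] := mass_linear_bound tpos tLT m0 gG tlim.
have drift := drift_inequality stationary inu Enu C0 HC.
have upper := mass_upper_bound tpos tLT m0 gG tlim.
apply: (classSstar_of_middle tpos tLT _ FE) => e.
exact: (convolution_middle_small tpos tLT m0 C0 inu mu_ge0 drift upper).
Qed.
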